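(* Let $G$ be a finite graph with $n$ vertices. Then $G$ is isomorphic to an induced subgraph of the fine curve graph $\mathcal{C}^\dagger(S_g)$, where $S_g$ is the closed orientable surface of genus $g\geq \binom{n}{2}-n+1$ (so one may take $g=O(n^2)$).
   Context: The fine curve graph $\mathcal{C}^\dagger(S)$ of a surface $S$ is the graph whose vertices are the embedded simple closed essential curves in $S$ (actual curves, not isotopy classes), with two distinct vertices joined by an edge if and only if the curves are disjoint.
   Formalization: The formal theorem additionally assumes g ≥ 1: for n = 1 or 2 the stated bound allows g = 0, but the sphere has no essential simple closed curves, so the claim fails there. *)

(* Defs.v *)
From HB Require Import structures.
From mathcomp Require Import all_boot all_order all_algebra generic_quotient.
From mathcomp Require Import all_classical all_reals all_analysis.
From Stdlib Require Relation_Operators.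
Set Implicit Arguments. Unset Strict Implicit. Unset Printing Implicit Defensive.
Import Order.TTheory GRing.Theory Num.Theory.
Import numFieldNormedType.Exports.
Local Open Scope classical_set_scope.
Local Open Scope ring_scope.

(* The closed orientable surface S_g (g >= 1), built as the standard    *)
(* quotient of the regular 4g-gon with boundary word                    *)
(*      a_1 b_1 a_1^-1 b_1^-1 ... a_g b_g a_g^-1 b_g^-1.               *)

Definition pvert (R : realType) (g k : nat) : R * R :=
  (cos (2 * pi * k%:R / (4 * g)%:R), sin (2 * pi * k%:R / (4 * g)%:R)).

Arguments pvert : clear implicits.

Definition polygon (R : realType) (g : nat) : set (R * R) :=
  [set p | exists w : 'I_(4 * g) -> R,
     (forall k, 0 <= w k) /\ \sum_(k < 4 * g) w k = 1 /\
     p = (\sum_(k < 4 * g) w k * (pvert R g k).1,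
          \sum_(k < 4 * g) w k * (pvert R g k).2)].

Definition pedge (R : realType) (g k : nat) (t : R) : R * R :=
  ((1 - t) * (pvert R g k).1 + t * (pvert R g k.+1).1,
   (1 - t) * (pvert R g k).2 + t * (pvert R g k.+1).2).

Arguments pedge : clear implicits.
Arguments polygon : clear implicits.

(* generating identifications: edge 4i (a_i) glued to edge 4i+2 (a_i^-1)
   reversing orientation, edge 4i+1 (b_i) glued to edge 4i+3 (b_i^-1). *)
Definition glue_gen (R : realType) (g : nat) (x y : set_type (polygon R g)) : Prop :=
  exists (i : nat) (t : R), (i < g)%N /\ 0 <= t <= 1 /\
    ((set_val x = pedge R g (4 * i) t /\ set_val y = pedge R g (4 * i + 2) (1 - t)) \/
     (set_val x = pedge R g (4 * i + 1) t /\ set_val y = pedge R g (4 * i + 3) (1 - t))).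

Definition glue_rel (R : realType) (g : nat) : rel (set_type (polygon R g)) :=
  fun x y => `[< Relation_Operators.clos_refl_sym_trans _ (@glue_gen R g) x y >].

Lemma glue_rel_refl R g : reflexive (@glue_rel R g).
Proof. by move=> x; apply/asboolP; apply: Relation_Operators.rst_refl. Qed.

Lemma glue_rel_sym R g : symmetric (@glue_rel R g).
Proof.
move=> x y; apply/asboolP/asboolP => H; exact: Relation_Operators.rst_sym.
Qed.

Lemma glue_rel_trans R g : transitive (@glue_rel R g).
Proof.
move=> y x z /asboolP Hxy /asboolP Hyz; apply/asboolP; exact: Relation_Operators.rst_trans Hxy Hyz.
Qed.

Canonical glue_equiv (R : realType) (g : nat) : equiv_rel (set_type (polygon R g)) :=
  @EquivRelPack _ (@glue_rel R g)
    (EquivClass (@glue_rel_refl R g) (@glue_rel_sym R g) (@glue_rel_trans R g)).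

Arguments glue_equiv : clear implicits.

Definition Sg (R : realType) (g : nat) :=
  quotient_topology {eq_quot (@glue_rel R g)}%qT.

Definition simple_closed_param (R : realType) (X : topologicalType)
    (gamma : R -> X) (C : set X) : Prop :=
  {within `[0, 1], continuous gamma} /\
  gamma 0 = gamma 1 /\
  (forall s t, s \in `[0, 1[ -> t \in `[0, 1[ -> gamma s = gamma t -> s = t) /\
  C = gamma @` `[0, 1].

Definition null_homotopic (R : realType) (X : topologicalType) (gamma : R -> X) : Prop :=
  exists H : R * R -> X,
    {within `[0, 1] `*` `[0, 1], continuous H} /\
    (forall t, t \in `[0, 1] -> H (0, t) = gamma t) /\
    (exists c : X, forall t, t \in `[0, 1] -> H (1, t) = c) /\
    (forall s, s \in `[0, 1] -> H (s, 0) = H (s, 1)).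

Arguments null_homotopic : clear implicits.
Arguments simple_closed_param : clear implicits.

Definition essential_curve (R : realType) (X : topologicalType) (C : set X) : Prop :=
  exists gamma : R -> X, simple_closed_param R X gamma C /\ ~ null_homotopic R X gamma.

Arguments essential_curve : clear implicits.

Definition induced_in_fine_curve_graph (R : realType) (X : topologicalType)
    (V : finType) (e : rel V) : Prop :=
  exists f : V -> set X,
    injective f /\
    (forall x, essential_curve R X (f x)) /\
    (forall x y, x != y -> (e x y <-> f x `&` f y = set0)).

Arguments induced_in_fine_curve_graph : clear implicits.

(* Main.v *)
(* Write V = {0, ..., n-1} (padded to n >= 3) and let the curves ("strands")
   run once around the centre of the 4g-gon, each at its own depth d_q below the
   boundary, strand 0 being the outermost. Every strand crosses the edge a_1 exactly
   once, so it has degree 1 under the map to the circle that winds along b_1 and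
   is essential.

   Disjointness is then adjusted pair by pair. Consecutive strands q, q+1 can be
   made to touch inside the first handle. For a pair i + 1 < j we use a handle of
   its own: strands i, ..., j-1 leave through the edge a_k and re-enter through
   a_k^-1, so that the edges b_k and b_k^-1 lie on different sides of them; strands
   above i follow the commutator, staying close to the vertex, and strands from j
   on pass below. Now i sees b_k^-1 from one side, j sees b_k from the other, and
   pulling both to the midpoint of this edge makes exactly i and j touch.

   This takes one handle for each pair i + 1 < j other than (0, n-1), plus the
   first handle, i.e. 'C(n-1, 2) handles. The pair (0, n-1) needs no handle: if
   the graph has an edge we number its ends 0 and n-1, and otherwise all
   strands are made to pass through a common point. *)
Require Import Defs.
From HB Require Import structures.
From mathcomp Require Import all_boot all_order all_algebra generic_quotient.
From mathcomp Require Import all_classical all_reals all_analysis.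
From mathcomp Require Import zify ring lra.
Set Implicit Arguments. Unset Strict Implicit. Unset Printing Implicit Defensive.
Import Order.TTheory GRing.Theory Num.Theory.
Import numFieldNormedType.Exports.
Local Open Scope classical_set_scope.
Local Open Scope ring_scope.

(** * Loops with a nontrivial lift are not null-homotopic *)

Section Winding.
Variable R : realType.

(** Heine-Cantor on [K], for continuity within [K] only; the near-covering form of compactness
    yields one radius for all centres. *)
Lemma compact_unif_within (T U : pseudoMetricType R) (K : set T) (f : T -> U) :
  compact K -> {within K, continuous f} -> forall e : R, 0 < e ->
  exists2 d : R, 0 < d &
    forall x y, K x -> K y -> ball x d y -> ball (f x) e (f y).
Proof.
move=> /compact_near_coveringP cK /subspace_continuousP fc e e0.
pose P (d : R) x := K x -> forall y, K y -> ball x d y -> ball (f x) e (f y).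
have nearP : \forall d \near 0^'+, K `<=` P d.
  apply: cK => x Kx.
  have e20 : 0 < e / 2 by rewrite divr_gt0.
  have /cvg_ballP/(_ (e / 2) e20) := fc x Kx.
  rewrite /prop_near1 /within /= => /nbhs_ballP[r /= r0 xr].
  (* With half of the radius, [x'] near [x] and [y] near [x'] both stay within [r] of [x]. *)
  exists (ball x (r / 2), [set d | 0 < d < r / 2]) => /=.
    split; first by apply: nbhsx_ballx; rewrite divr_gt0.
    near=> d; apply/andP; split => //.
    near: d; apply: nbhs_right_lt; lra.
  move=> [x' d] /= [xx' /andP[d0 dr]] Kx' y Ky x'y.
  rewrite (splitr e); apply: (@ball_triangle _ _ (f x)).
    by apply: ball_sym; apply: xr Kx'; apply: le_ball xx'; lra.
  apply: (xr y _ Ky).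
  rewrite (splitr r); apply: ball_triangle xx' _; apply: le_ball x'y; exact: ltW.
near (0:R)^'+ => d.
exists d => //.
move=> x y Kx Ky; apply: (near nearP d) => //.
Unshelve. all: by end_near. Qed.

Lemma periodicz (f : R -> R) (T : R) : periodic f T ->
  forall a (k : int), f (a + T *~ k) = f a.
Proof.
move=> fT a [n|n]; first exact: (periodicn fT).
by rewrite NegzE mulrNz -[LHS](periodicn fT n.+1) subrK.
Qed.

Lemma cos_sin_int (r : R) (k : int) :
  cos (2 * pi * (r + k%:~R)) = cos (2 * pi * r) /\
  sin (2 * pi * (r + k%:~R)) = sin (2 * pi * r).
Proof.
have -> : 2 * pi * (r + k%:~R) = 2 * pi * r + (pi *+ 2) *~ k.
  by rewrite -mulrzr; ring.
by rewrite (periodicz (@cosD2pi R)) (periodicz (@sinD2pi R)).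
Qed.

(** The nearest integer works: at distance at least 1/4 from it, the angle lies in [[pi/2, pi]] up
    to sign, where the cosine is not positive. *)
Lemma cos_gt0_near_int (r : R) : 0 < cos (2 * pi * r) ->
  exists k : int, `|r - k%:~R| < 1 / 4.
Proof.
move=> cr; exists (Num.floor (r + 1 / 2)).
set k := Num.floor _; set s := r - _.
have /andP[k1] := floor_itv (r + 1 / 2); rewrite -/k intrD => k2.
have cs : cos (2 * pi * s) = cos (2 * pi * r).
  by rewrite -[in RHS](subrK k%:~R r) (cos_sin_int _ k).1.
have pi0 := pi_gt0 R.
rewrite ltNge; apply/negP => s4.
move: cr; rewrite -cs -cos_norm !normrM (ger0_norm (ltW pi0)) ger0_norm//.
set u := `|s| in s4 *.
have u2 : u <= 1 / 2 by rewrite /u ler_norml; apply/andP; split; rewrite /s; lra.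
have : cos (2 * pi * u) <= cos (pi / 2).
  rewrite leNgt ltr_cos ?in_itv/=; first by rewrite -leNgt; nra.
    by apply/andP; split; nra.
  by apply/andP; split; nra.
rewrite cos_pihalf; lra.
Qed.

(* The representative of r modulo 1 in [-1/2, 1/2[. *)
Definition wrap (r : R) : R := r - (Num.floor (r + 1 / 2))%:~R.

Lemma wrapE (r : R) (k : int) : `|r - k%:~R| < 1 / 4 -> wrap r = r - k%:~R.
Proof.
rewrite ltr_norml => /andP[h1 h2]; rewrite /wrap (@floor_def _ _ k)//.
by rewrite intrD; apply/andP; split; lra.
Qed.

Lemma wrap_int (r : R) (k : int) : wrap (r + k%:~R) = wrap r.
Proof. by rewrite /wrap [_ + 1 / 2]addrAC floorDrz ?intr_int// intrKfloor intrD; ring. Qed.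

Definition small (r : R) := exists k : int, `|r - k%:~R| < 1 / 4.

Lemma wrap_small r : small r -> `|wrap r| < 1 / 4.
Proof. by move=> [k rk]; rewrite (wrapE rk). Qed.

(** The two sides differ by an integer, and four terms below 1/4 keep this integer below 1 in
    absolute value. *)
Lemma wrap_square (a b c d : R) : a + b = c + d ->
  small a -> small b -> small c -> small d -> wrap a + wrap b = wrap c + wrap d.
Proof.
move=> abcd /wrap_small + /wrap_small + /wrap_small + /wrap_small.
rewrite /wrap; set i := Num.floor _; set j := Num.floor _; set k := Num.floor _.
set l := Num.floor _.
rewrite !ltr_norml => /andP[a1 a2] /andP[b1 b2] /andP[c1 c2] /andP[d1 d2].
have : `|(i + j - k - l)%:~R : R| < 1.
  by rewrite !intrD !intrN ltr_norml; apply/andP; split; lra.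
rewrite -intr_norm ltrz1 => ijkl.
have : i + j - k - l = 0 by lia.
move=> /(congr1 (fun z : int => z%:~R : R)); rewrite !intrD !intrN; lra.
Qed.
End Winding.

Lemma within_continuous_comp (S T U : topologicalType) (A : set S) (h : S -> T)
  (k : T -> U) : {within A, continuous h} -> continuous k ->
  {within A, continuous (k \o h)}.
Proof.
move=> /subspace_continuousP hc kc; apply/subspace_continuousP => x Ax.
exact: cvg_comp (hc x Ax) (kc (h x)).
Qed.

(** * Winding numbers along a homotopy *)

Section Obstruction.
Variables (R : realType) (X : topologicalType) (phi : X -> R).
(** [phi] represents a continuous map from [X] to [R/Z] by real values that may jump by integers;
    continuity is therefore expressed through cosine and sine. *)
Hypothesis cos_phi : continuous (fun x => cos (2 * pi * phi x)).
Hypothesis sin_phi : continuous (fun x => sin (2 * pi * phi x)).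

(** The squared chord, 2 minus twice the cosine of the angle difference, is below 1/2, so that
    cosine is positive. *)
Lemma close_small (a b : R) :
  `|cos (2 * pi * a) - cos (2 * pi * b)| < 1 / 2 ->
  `|sin (2 * pi * a) - sin (2 * pi * b)| < 1 / 2 -> small (b - a).
Proof.
move=> c s; apply: cos_gt0_near_int; rewrite mulrBr cosB.
move: c s; rewrite !ltr_norml => /andP[c1 c2] /andP[s1 s2].
have := cos2Dsin2 (2 * pi * a); have := cos2Dsin2 (2 * pi * b).
move: (cos _) (sin _) (cos _) (sin _) c1 c2 s1 s2 => cb sb ca sa.
nra.
Qed.

Lemma homotopy_small (H : R * R -> X) :
  {within `[0, 1] `*` `[0, 1], continuous H} ->
  exists2 d : R, 0 < d & forall p q : R * R,
    (`[0, 1] `*` `[0, 1]) p -> (`[0, 1] `*` `[0, 1]) q ->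
    ball p d q -> small (phi (H q) - phi (H p)).
Proof.
move=> Hc.
have sq : compact (`[0:R, 1] `*` `[0:R, 1]).
  by apply: compact_setX; exact: segment_compact.
have e0 : 0 < 1 / 2 :> R by lra.
have cc : {within `[0, 1] `*` `[0, 1], continuous (fun p => cos (2 * pi * phi (H p)))}.
  exact: within_continuous_comp Hc cos_phi.
have ss : {within `[0, 1] `*` `[0, 1], continuous (fun p => sin (2 * pi * phi (H p)))}.
  exact: within_continuous_comp Hc sin_phi.
have [d1 d10 h1] := compact_unif_within sq cc e0.
have [d2 d20 h2] := compact_unif_within sq ss e0.
exists (Num.min d1 d2); first by rewrite lt_min d10.
move=> p q Kp Kq pq; apply: close_small.
  by apply: h1 => //; apply: le_ball pq; rewrite ge_min lexx.
by apply: h2 => //; apply: le_ball pq; rewrite ge_min lexx orbT.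
Qed.

(** [W j] adds the wrapped increments of [phi] along row [j] of a fine grid on the homotopy square.
    Adjacent rows have equal sums: increments cancel around each cell, and the vertical ones agree
    at both ends of the loop. The last row is constant, so its sum is 0, whereas the first row sums
    to [f 1 - f 0]. *)
Lemma not_null_homotopic_lift (gamma : R -> X) (f : R -> R) :
  {within `[0, 1], continuous f} ->
  (forall t, t \in `[0, 1] -> exists k : int, f t = phi (gamma t) + k%:~R) ->
  f 1 != f 0 -> ~ null_homotopic R X gamma.
Proof.
move=> fc fphi f01 [H [Hc [H0 [[c H1] Hper]]]].
have [d d0 Hd] := homotopy_small Hc.
have e0 : 0 < 1 / 4 :> R by lra.
have [d' d'0 fd] := compact_unif_within (@segment_compact _ 0 1) fc e0.
have [M Md] : exists M : nat, (M.+1)%:R^-1 < Num.min d d'.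
  exists (Num.truncn (Num.min d d')^-1).
  rewrite invf_plt ?posrE ?lt_min ?d0 ?ltr0n//; exact: truncnS_gt.
pose t i : R := i%:R / M.+1%:R.
have t01 i : (i <= M.+1)%N -> t i \in `[0, 1].
  move=> iM; rewrite in_itv/= /t divr_ge0//= ler_pdivrMr ?ltr0n// mul1r.
  by rewrite ler_nat.
have t0 : t 0%N = 0 by rewrite /t mul0r.
have t1 : t M.+1 = 1 by rewrite /t divff// pnatr_eq0.
have tS i r : M.+1%:R^-1 < r -> ball (t i) r (t i.+1).
  move=> Mr; rewrite /ball /= /t -mulrBl -natr1.
  have -> : i%:R - (i%:R + 1) = -1 :> R by ring.
  by rewrite mulN1r normrN ger0_norm.
have Mmin : (0 < Num.min d d')%R by rewrite lt_min d0.
have Md1 : M.+1%:R^-1 < d by apply: lt_le_trans Md _; rewrite ge_min lexx.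
have Md2 : M.+1%:R^-1 < d' by apply: lt_le_trans Md _; rewrite ge_min lexx orbT.
have tt i r : 0 < r -> ball (t i) r (t i) by move=> r0; exact: ballxx.
pose x j i := phi (H (t j, t i)).
pose h j i := wrap (x j i.+1 - x j i).
pose v j i := wrap (x j.+1 i - x j i).
pose W j := \sum_(0 <= i < M.+1) h j i.
have hsmall j i : (j <= M.+1)%N -> (i < M.+1)%N -> small (x j i.+1 - x j i).
  move=> jM iM; apply: Hd.
  - by split; apply: t01 => //; exact: ltnW.
  - by split; apply: t01.
  - by split; [exact: tt|exact: tS].
have vsmall j i : (j < M.+1)%N -> (i <= M.+1)%N -> small (x j.+1 i - x j i).
  move=> jM iM; apply: Hd.
  - by split; apply: t01 => //; exact: ltnW.
  - by split; apply: t01.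
  - by split; [exact: tS|exact: tt].
have xper j : (j <= M.+1)%N -> x j 0%N = x j M.+1.
  by move=> jM; rewrite /x t0 t1 Hper//; exact: t01.
have WS j : (j < M.+1)%N -> W j.+1 = W j.
  move=> jM; apply/eqP; rewrite -subr_eq0 /W -sumrB.
  have -> : \sum_(0 <= i < M.+1) (h j.+1 i - h j i) =
            \sum_(0 <= i < M.+1) (v j i.+1 - v j i).
    apply: eq_big_nat => i /andP[_ iM].
    have := @wrap_square R (x j i.+1 - x j i) (x j.+1 i.+1 - x j i.+1)
      (x j.+1 i - x j i) (x j.+1 i.+1 - x j.+1 i).
    rewrite -/(h j i) -/(v j i.+1) -/(v j i) -/(h j.+1 i) => sq.
    suff : h j i + v j i.+1 = v j i + h j.+1 i by lra.
    apply: sq; first by ring.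
    - exact: hsmall (ltnW _) _.
    - exact: vsmall.
    - exact: vsmall (ltnW _).
    - exact: hsmall.
  rewrite (@telescope_sumr _ 0 M.+1 (v j) (leq0n _)).
  by rewrite subr_eq0 /v (xper j (ltnW jM)) (xper j.+1 jM).
have W0 j : (j <= M.+1)%N -> W j = W 0%N.
  by elim: j => [//|j IH] jM; rewrite (WS j jM); apply: IH; exact: ltnW.
have WM : W M.+1 = 0.
  rewrite /W big_nat; apply: big1 => i /andP[_ iM].
  rewrite /h /x t1 (H1 _ (t01 _ iM)) (H1 _ (t01 _ (ltnW iM))).
  by rewrite subrr (@wrapE _ _ 0) ?subr0 ?normr0.
suff fW : f (t M.+1) - f (t 0%N) = 0.
  by move: fW f01; rewrite t1 t0 -subr_eq0 => ->; rewrite eqxx.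
rewrite -[LHS](@telescope_sumr _ 0 M.+1 (f \o t) (leq0n _)).
suff -> : \sum_(0 <= k < M.+1) ((f \o t) k.+1 - (f \o t) k) = W 0%N.
  by rewrite -(W0 M.+1 (leqnn _)).
apply: eq_big_nat => i /andP[_ iM] /=.
rewrite /h /x t0 (H0 _ (t01 _ iM)) (H0 _ (t01 _ (ltnW iM))).
have [k kE] := fphi _ (t01 i (ltnW iM)); have [l lE] := fphi _ (t01 i.+1 iM).
(* Increments of [phi] and of the continuous [f] differ by integers; those of [f] are below 1/4, so
   wrapping returns them exactly. *)
have -> : phi (gamma (t i.+1)) - phi (gamma (t i)) = f (t i.+1) - f (t i) + (k - l)%:~R.
  by rewrite intrB; lra.
rewrite wrap_int (@wrapE _ _ 0) ?subr0//.
have : ball (f (t i)) (1 / 4) (f (t i.+1)).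
  by apply: fd; [exact: t01 (ltnW iM)|exact: t01|exact: tS].
by rewrite /ball /= distrC.
Qed.
End Obstruction.

(** * Triangles of the polygon and gluing *)

Section Sectors.
Variables (R : realType) (g : nat).
Hypothesis g_pos : (0 < g)%N.
Local Notation V := (pvert R g).
Local Notation N := (4 * g)%N.

Definition tau : R := 2 * pi / N%:R.

Lemma N_gt0 : 0 < N%:R :> R. Proof. by rewrite ltr0n muln_gt0. Qed.

Lemma tau_gt0 : 0 < tau.
Proof. by rewrite /tau divr_gt0 ?N_gt0// mulr_gt0 ?pi_gt0. Qed.

Lemma tauN : tau * N%:R = 2 * pi.
Proof. by rewrite /tau divfK// lt0r_neq0// N_gt0. Qed.

Lemma tau_le : tau <= pi / 2.
Proof.
have gR : 1 <= g%:R :> R by rewrite ler1n.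
have := tauN; rewrite natrM => t4; have := tau_gt0; have := pi_gt0 R; nra.
Qed.

Lemma pvertE k : V k = (cos (k%:R * tau), sin (k%:R * tau)).
Proof.
rewrite /pvert /tau; congr (cos _, sin _); ring.
Qed.

Lemma pvertN : V N = V 0%N.
Proof.
rewrite !pvertE [_ * tau]mulrC tauN mul0r cos0 sin0.
by rewrite mulr_natl cos2pi sin2pi.
Qed.

(* Coordinates on the triangle spanned by the centre 0 and the edge e: the
   boundary is a + b = 1, and pedge e t is sector e (1 - t) t. *)
Definition sector (e : nat) (a b : R) : R * R :=
  (a * (V e).1 + b * (V e.+1).1, a * (V e).2 + b * (V e.+1).2).

Definition det (p q : R * R) := p.1 * q.2 - p.2 * q.1.

Lemma det_pvert i j : det (V i) (V j) = sin ((j%:R - i%:R) * tau).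
Proof. by rewrite !pvertE /det /= mulrBl sinB; ring. Qed.

Lemma det_sector p e a b :
  det p (sector e a b) = a * det p (V e) + b * det p (V e.+1).
Proof. by rewrite /det /sector /=; ring. Qed.

Lemma sin_le0_pi (x : R) : pi <= x <= 2 * pi -> sin x <= 0.
Proof.
move=> /andP[x1 x2]; rewrite -[x](subrK pi) sinDpi oppr_le0.
by apply: sin_ge0_pi; lra.
Qed.

Lemma sin_lt0_pi (x : R) : pi < x < 2 * pi -> sin x < 0.
Proof.
move=> /andP[x1 x2]; rewrite -[x](subrK pi) sinDpi oppr_lt0.
by apply: sin_gt0_pi; lra.
Qed.

Lemma sin_tau_gt0 : 0 < sin tau.
Proof. by apply: sin_gt0_pi; rewrite tau_gt0 /=; have := tau_le; have := pi_gt0 R; lra. Qed.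

(* Compare determinants with the vertex e.+1 if the angle from e to f is at most
   pi, and with the vertex e otherwise: the two sides have opposite signs. *)
Lemma sector_le_inj e f a b a' b' : (e <= f)%N -> (f < N)%N ->
  0 < a -> 0 <= b -> 0 < a' -> 0 <= b' ->
  sector e a b = sector f a' b' -> [/\ e = f, a = a' & b = b'].
Proof.
move=> ef fN a0 b0 a'0 b'0 /[dup] /(congr1 (det (V e.+1))) + /(congr1 (det (V e))).
rewrite !det_sector !det_pvert !subrr mul0r sin0.
have -> : e%:R - e.+1%:R = -1 :> R by rewrite -natr1; ring.
have -> : e.+1%:R - e%:R = 1 :> R by rewrite -natr1; ring.
have -> : f.+1%:R - e.+1%:R = f%:R - e%:R :> R by rewrite -!natr1; ring.
have -> : f%:R - e.+1%:R = f%:R - e%:R - 1 :> R by rewrite -!natr1; ring.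
have -> : f.+1%:R - e%:R = f%:R - e%:R + 1 :> R by rewrite -!natr1; ring.
rewrite -natrB//; have := subnKC ef; set m := (f - e)%N => mE.
rewrite mulN1r sinN mul1r mulr0 addr0 mulr0 add0r.
have s0 := sin_tau_gt0; have t0 := tau_gt0; have p0 := pi_gt0 R; have tN := tauN.
case: (posnP m) => [m0|mpos].
  rewrite m0 sub0r add0r mulN1r mul1r mul0r sin0 sinN mulr0 addr0 mulr0 add0r => h1 h2.
  split; first by rewrite -mE m0 addn0.
  - by apply: (mulIf (lt0r_neq0 s0)); lra.
  - by apply: (mulIf (lt0r_neq0 s0)); lra.
have mN : (m < N)%N by apply: leq_ltn_trans fN; rewrite -mE leq_addl.
have m1 : 1 <= m%:R :> R by rewrite ler1n.
have mlt : m%:R + 1 <= N%:R :> R by rewrite natr1 ler_nat.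
case: (lerP (m%:R * tau) pi) => hm h1 h2; exfalso.
  have : 0 <= sin ((m%:R - 1) * tau) by apply: sin_ge0_pi; nra.
  have : 0 <= sin (m%:R * tau) by apply: sin_ge0_pi; nra.
  nra.
have : sin (m%:R * tau) < 0 by apply: sin_lt0_pi; rewrite hm/=; nra.
have : sin ((m%:R + 1) * tau) <= 0 by apply: sin_le0_pi; nra.
nra.
Qed.

Lemma sector_inj e f a b a' b' : (e < N)%N -> (f < N)%N ->
  0 < a -> 0 <= b -> 0 < a' -> 0 <= b' ->
  sector e a b = sector f a' b' -> [/\ e = f, a = a' & b = b'].
Proof.
move=> eN fN a0 b0 a'0 b'0 s; case: (leqP e f) => ef.
  exact: sector_le_inj s.
by have [-> -> ->] := sector_le_inj (ltnW ef) eN a'0 b'0 a0 b0 (esym s).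
Qed.
End Sectors.

(** * The quotient of the polygon and its point classes *)

Section Gluing.
Variables (R : realType) (g : nat).
Hypothesis g_pos : (0 < g)%N.
Local Notation V := (pvert R g).
Local Notation N := (4 * g)%N.
Local Notation sector := (@sector R g).

Lemma polygon_conv p q r (a b c : R) : 0 <= a -> 0 <= b -> 0 <= c -> a + b + c = 1 ->
  polygon R g p -> polygon R g q -> polygon R g r ->
  polygon R g (a * p.1 + b * q.1 + c * r.1, a * p.2 + b * q.2 + c * r.2).
Proof.
move=> a0 b0 c0 abc [u [u0 [u1 ->]]] [v [v0 [v1 ->]]] [w [w0 [w1 ->]]].
exists (fun k => a * u k + b * v k + c * w k); split => [k|].
  by rewrite !addr_ge0// mulr_ge0.
split; first by rewrite !big_split/= -!mulr_sumr u1 v1 w1 !mulr1.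
by congr (_, _); rewrite /= !mulr_sumr -!big_split/=; apply: eq_bigr => k _; ring.
Qed.

Lemma polygon_pvert k : (k <= N)%N -> polygon R g (V k).
Proof.
wlog kN : k / (k < N)%N => [H|_].
  rewrite leq_eqVlt => /orP[/eqP->|kN]; last exact: H kN (ltnW kN).
  by rewrite pvertN//; apply: H; rewrite // muln_gt0.
exists (fun i => (i == Ordinal kN)%:R); split => //.
have pick (h : nat -> R) : \sum_(i < N) (i == Ordinal kN)%:R * h i = h k.
  rewrite (bigD1 (Ordinal kN))//= eqxx mul1r big1 ?addr0// => i /negPf->.
  by rewrite mul0r.
split; first by rewrite -[RHS](pick (fun=> 1)); apply: eq_bigr => i _; rewrite mulr1.
by rewrite (pick (fun i => (V i).1)) (pick (fun i => (V i).2)); case: (V k).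
Qed.

(** The opposite vertices [V 0] and [V (2 * g)] have midpoint 0. *)
Lemma polygon_center : polygon R g (0, 0).
Proof.
have V0 : polygon R g (V 0) by exact: polygon_pvert.
have V2 : polygon R g (V (2 * g)%N) by apply: polygon_pvert; lia.
have := @polygon_conv _ _ _ (1 / 2) (1 / 2) 0 _ _ _ _ V0 V2 V0.
rewrite !pvertE// /= mul0r cos0 sin0.
have -> : (2 * g)%:R * tau R g = pi.
  by have := tauN R g_pos; rewrite !natrM; lra.
rewrite cospi sinpi.
have -> : 1 / 2 * 1 + 1 / 2 * -1 + 0 * 1 = 0 :> R by ring.
have -> : 1 / 2 * 0 + 1 / 2 * 0 + 0 * 0 = 0 :> R by ring.
apply; lra.
Qed.

Lemma polygon_sector e a b : (e < N)%N -> 0 <= a -> 0 <= b -> a + b <= 1 ->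
  polygon R g (sector e a b).
Proof.
move=> eN a0 b0 ab.
have := @polygon_conv _ _ _ a b (1 - a - b) a0 b0 _ _
  (polygon_pvert (ltnW eN)) (polygon_pvert eN) polygon_center.
by rewrite /= !mulr0 !addr0; apply; lra.
Qed.

Definition center : set_type (polygon R g) := exist _ (0, 0) (mem_set polygon_center).

(** Made total by sending points outside the polygon to the class of the centre, so that paths can
    be plain maps into the plane. *)
Definition proj (p : R * R) : Sg R g := \pi_(Sg R g)%qT (insubd center p).

Lemma proj_continuous : {within polygon R g, continuous proj}.
Proof.
apply/subspace_sigL_continuousP.
suff -> : sigL (polygon R g) proj = \pi_(Sg R g)%qT by exact: pi_continuous.
apply/funext => x; rewrite /sigL /proj /=; congr (\pi _)%qT.
by apply: val_inj; rewrite val_insubd; case: ifP => // /negP[]; exact: (valP x).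
Qed.

Lemma proj_eqP p q :
  proj p = proj q <->
  Relation_Operators.clos_refl_sym_trans _ (@glue_gen R g)
    (insubd center p) (insubd center q).
Proof.
split; first by move/(@eqmodP _ (glue_equiv R g)) => /asboolP.
by move=> h; apply/(@eqmodP _ (glue_equiv R g))/asboolP.
Qed.

(* The edge glued to e. *)
Definition mate e := if (e %% 4 < 2)%N then (e + 2)%N else (e - 2)%N.

Lemma mate_lt e : (e < N)%N -> (mate e < N)%N.
Proof. rewrite /mate; case: ifP; lia. Qed.

Lemma mateK : involutive mate.
Proof. move=> e; rewrite /mate; do 2 case: ifP; lia. Qed.

Lemma mate_a i : mate (4 * i)%N = (4 * i + 2)%N.
Proof. rewrite /mate; case: ifP; lia. Qed.

Lemma mate_b i : mate (4 * i + 1)%N = (4 * i + 3)%N.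
Proof. rewrite /mate; case: ifP; lia. Qed.

Lemma glue_genE (y z : set_type (polygon R g)) : glue_gen y z -> exists u t,
  [/\ (u < N)%N, 0 <= t <= 1,
      set_val y = sector u (1 - t) t & set_val z = sector (mate u) t (1 - t)].
Proof.
have t1t t : 1 - (1 - t) = t :> R by ring.
move=> [i [t [ig [t01 [[yE zE]|[yE zE]]]]]].
  exists (4 * i)%N, t; split => //; first by rewrite ltn_pmul2l.
  by rewrite zE /pedge t1t mate_a.
exists (4 * i + 1)%N, t; split => //; first by lia.
by rewrite zE /pedge t1t mate_b.
Qed.

Lemma val_insubd_polygon p : polygon R g p -> set_val (insubd center p) = p.
Proof. by move=> pp; rewrite set_valE val_insubd mem_set. Qed.

Lemma edge_polygon e t : (e < N)%N -> 0 <= t <= 1 -> polygon R g (sector e (1 - t) t).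
Proof. by move=> eN /andP[t0 t1]; apply: polygon_sector => //; lra. Qed.

Lemma proj_mate e t : (e < N)%N -> 0 <= t <= 1 ->
  proj (sector e (1 - t) t) = proj (sector (mate e) t (1 - t)).
Proof.
move=> eN t01; have t01' : 0 <= 1 - t <= 1 by lra.
have t1t : 1 - (1 - t) = t by ring.
have pm := edge_polygon (mate_lt eN) t01'; rewrite t1t in pm.
have pe := edge_polygon eN t01.
have [i [ig [eE|[eE|[eE|eE]]]]] : exists i, (i < g)%N /\
  (e = 4 * i \/ e = 4 * i + 1 \/ e = 4 * i + 2 \/ e = 4 * i + 3)%N.
  by exists (e %/ 4)%N; split; lia.
- apply/proj_eqP/Relation_Operators.rst_step; exists i, t; split => //; split => //.
  left; rewrite !val_insubd_polygon// eE; split => //.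
  by rewrite /pedge t1t /mate -eE; case: ifP => //; lia.
- apply/proj_eqP/Relation_Operators.rst_step; exists i, t; split => //; split => //.
  right; rewrite !val_insubd_polygon// eE; split => //.
  by rewrite /pedge t1t /mate -eE; case: ifP; last lia; rewrite eE -addnA.
- apply/esym/proj_eqP/Relation_Operators.rst_step; exists i, (1 - t); split => //; split => //.
  left; rewrite !val_insubd_polygon// t1t eE; split => //.
  by rewrite /pedge t1t /mate -eE; case: ifP; [lia|]; rewrite eE addnK.
- apply/esym/proj_eqP/Relation_Operators.rst_step; exists i, (1 - t); split => //; split => //.
  right; rewrite !val_insubd_polygon// t1t eE; split => //.
  by rewrite /pedge t1t /mate -eE; case: ifP; [lia|]; rewrite eE -addnBA.
Qed.

Lemma edge_at e t f a b : (e < N)%N -> 0 <= t <= 1 -> (f < N)%N ->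
  0 < a < 1 -> 0 <= b -> sector e (1 - t) t = sector f a b ->
  [/\ e = f, 1 - t = a & t = b].
Proof.
move=> eN /andP[t0 t1] fN /andP[a0 a1] b0 s.
case: (ltrP t 1) => t1'.
  by apply: sector_inj s => //; lra.
have {t0 t1 t1'} tE : t = 1 by lra.
exfalso; move: s; rewrite tE subrr.
(* At [t = 1] the first coordinate vanishes and [sector_inj] does not apply. The end vertex is
   rewritten as the start of the cyclically next triangle, where injectivity would force [a = 1]. *)
have [h hN ->] : exists2 h, (h < N)%N & sector e 0 1 = sector h 1 0.
  have [eN'|eN'] := ltnP e.+1 N.
    by exists e.+1 => //; rewrite /sector /=; congr (_, _); ring.
  exists 0%N; first by lia.
  have -> : e = N.-1 by lia.
  rewrite /sector prednK ?muln_gt0// pvertN//; congr (_, _); ring.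
by move=> /sector_inj[]//; lra.
Qed.

(** [Q] is the candidate class of the point: the point itself and, if it is on an edge, its mirror
    image on the glued edge. The generators preserve [Q], because [0 < a < 1] excludes the vertices
    and the centre and makes triangle coordinates unique. *)
Lemma proj_sector_inj e f a b a' b' : (e < N)%N -> (f < N)%N ->
  0 < a < 1 -> 0 <= b -> a + b <= 1 -> 0 < a' < 1 -> 0 <= b' -> a' + b' <= 1 ->
  proj (sector e a b) = proj (sector f a' b') ->
  [/\ e = f, a = a' & b = b'] \/ [/\ f = mate e, a + b = 1, a' = b & b' = a].
Proof.
move=> eN fN a01 b0 ab a'01 b'0 ab' /proj_eqP.
have /andP[a0 a1] := a01; have /andP[a'0 a'1] := a'01.
pose Q (y : set_type (polygon R g)) := set_val y = sector e a b \/
  (a + b = 1 /\ set_val y = sector (mate e) b a).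
have Qmate u t y z : (u < N)%N -> 0 <= t <= 1 ->
    set_val y = sector u (1 - t) t -> set_val z = sector (mate u) t (1 - t) ->
    Q y -> Q z.
  move=> uN t01 yu zu; rewrite /Q yu zu => -[yE|[ab1 yE]].
    have [ue ta tb] := edge_at uN t01 eN a01 b0 yE.
    by right; split; [lra|rewrite ue ta tb].
  have b01 : 0 < b < 1 by lra.
  have [ue tb ta] := edge_at uN t01 (mate_lt eN) b01 (ltW a0) yE.
  by left; rewrite ue mateK tb ta.
have Qglue y z : glue_gen y z -> (Q y <-> Q z).
  move=> /glue_genE[u [t [uN t01 yE zE]]].
  have t01' : 0 <= 1 - t <= 1 by lra.
  have t1t : 1 - (1 - t) = t by ring.
  split; first exact: Qmate yE zE.
  by apply: (Qmate (mate u) (1 - t)); rewrite ?mateK ?t1t// mate_lt.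
have Qrst y z : Relation_Operators.clos_refl_sym_trans _ (@glue_gen R g) y z ->
    (Q y <-> Q z).
  move=> yz; elim: yz => {y z}.
  - exact: Qglue.
  - by move=> y.
  - by move=> y z _ [yz zy]; split.
  - by move=> y w z _ [yw wy] _ [wz zw]; split => [/yw/wz|/zw/wy].
have pe := polygon_sector eN (ltW a0) b0 ab.
have pf := polygon_sector fN (ltW a'0) b'0 ab'.
have Qe : Q (insubd center (sector e a b)) by left; rewrite val_insubd_polygon.
move=> /Qrst[/(_ Qe) + _].
rewrite /Q val_insubd_polygon// => -[/esym s|].
  by left; apply: sector_inj s.
move=> [ab1 s]; right.
have b_gt0 : 0 < b by lra.
by have [-> -> ->] := sector_inj g_pos fN (mate_lt eN) a'0 b'0 b_gt0 (ltW a0) s.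
Qed.
End Gluing.

(** * A map from the surface to the circle *)

Section CircleMap.
Variables (R : realType) (g : nat).
Hypothesis g_pos : (0 < g)%N.
Local Notation V := (pvert R g).
Local Notation N := (4 * g)%N.
Local Notation sector := (@sector R g).
Local Notation t := (tau R g).

(* The affine function equal to 1 on the edge 2 and to 0 at the vertices 1 and 4. *)
Definition slope (p : R * R) : R :=
  (p.1 * cos (5 / 2 * t) + p.2 * sin (5 / 2 * t) - cos (3 / 2 * t)) /
  (cos (1 / 2 * t) - cos (3 / 2 * t)).

(* Its glued values on b_1 and b_1^-1 agree, and the values on a_1 and a_1^-1
   differ by 1, so that ramp descends to a map from the surface to R/Z. *)
Definition ramp (p : R * R) : R := Num.max 0 (Num.min 1 (slope p)).

Lemma cos_half_lt : cos (3 / 2 * t) < cos (1 / 2 * t).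
Proof.
have := tau_gt0 R g_pos; have := tau_le R g_pos; have := pi_gt0 R => p0 t1 t0.
by rewrite ltr_cos ?in_itv/=; [lra|apply/andP; split; lra|apply/andP; split; lra].
Qed.

(** The direction [5 / 2 * t] bisects the edge 2, so the value depends only on the angular distance
    of the vertex from it. *)
Lemma slope_pvert k : slope (V k) =
  (cos ((k%:R - 5 / 2) * t) - cos (3 / 2 * t)) / (cos (1 / 2 * t) - cos (3 / 2 * t)).
Proof.
by rewrite /slope pvertE//=; congr ((_ - _) / _); rewrite -cosB; congr cos; ring.
Qed.

Lemma slope_edge e (s : R) :
  slope (sector e (1 - s) s) = (1 - s) * slope (V e) + s * slope (V e.+1).
Proof.
rewrite /slope /sector /=.
set d := (cos _ - _)^-1; ring.
Qed.

Lemma slope_1 k : (k == 2) || (k == 3) -> slope (V k) = 1.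
Proof.
move=> k23; rewrite slope_pvert.
have -> : cos ((k%:R - 5 / 2) * t) = cos (1 / 2 * t).
  by case/orP: k23 => /eqP->; [rewrite -cosN|]; congr cos; lra.
by rewrite divff// subr_eq0 gt_eqF// cos_half_lt.
Qed.

Lemma slope_0 k : (k == 1) || (k == 4) -> slope (V k) = 0.
Proof.
move=> k23; rewrite slope_pvert.
have -> : cos ((k%:R - 5 / 2) * t) = cos (3 / 2 * t).
  by case/orP: k23 => /eqP->; [rewrite -cosN|]; congr cos; lra.
by rewrite subrr mul0r.
Qed.

(** The angle from the bisector of the edge 2 runs from [3 / 2 * t] to [2 * pi - 5 / 2 * t]; the
    cosine decreases up to [pi] and is symmetric about [pi]. *)
Lemma slope_le0 k : (4 <= k <= N)%N -> slope (V k) <= 0.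
Proof.
move=> /andP[k4 kN]; rewrite slope_pvert.
rewrite pmulr_lle0 ?invr_gt0 ?subr_gt0 ?cos_half_lt// subr_le0.
have k4R : 4 <= k%:R :> R by rewrite (ler_nat _ 4).
have kNR : k%:R <= N%:R :> R by rewrite ler_nat.
have := tau_gt0 R g_pos; have := tau_le R g_pos; have := pi_gt0 R => p0 t1 t0.
have tN := tauN R g_pos.
have a1 : 3 / 2 * t <= (k%:R - 5 / 2) * t by rewrite ler_pM2r//; lra.
have a2 : (k%:R - 5 / 2) * t <= 2 * pi - 5 / 2 * t by rewrite -tN; nra.
move: ((k%:R - 5 / 2) * t) a1 a2 => u a1 a2.
have aux w : 3 / 2 * t <= w -> w <= pi -> cos w <= cos (3 / 2 * t).
  move=> w1 w2; rewrite leNgt ltr_cos ?in_itv/=; first by rewrite -leNgt.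
    by apply/andP; split; lra.
  by apply/andP; split; lra.
case: (lerP u pi) => u1; first exact: aux.
have -> : cos u = cos (2 * pi - u).
  by rewrite -cosN -(@cosD2pi R (- u)); congr cos; ring.
by apply: aux; lra.
Qed.

Lemma ramp_edge e (s : R) : 0 <= s <= 1 -> (e < N)%N ->
  ramp (sector e (1 - s) s) = match e with 1%N => s | 2%N => 1 | 3%N => 1 - s | _ => 0 end.
Proof.
move=> /andP[s0 s1] eN; rewrite /ramp slope_edge.
have low x : x <= 0 -> Num.max 0 (Num.min 1 x) = 0 :> R.
  by move=> x0; apply/max_idPl; rewrite ge_min x0 orbT.
have mid x : 0 <= x <= 1 -> Num.max 0 (Num.min 1 x) = x :> R.
  move=> /andP[x0 x1]; have -> : Num.min 1 x = x by apply/min_idPr.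
  exact/max_idPr.
move: e eN => [|[|[|[|e]]]] eN.
- rewrite low// (@slope_0 1)// mulr0 addr0 mulr_ge0_le0 ?subr_ge0//.
  (* The start of the edge 0 is treated as vertex [N], which is in the range of [slope_le0]. *)
  by rewrite -(pvertN R g_pos); apply: slope_le0; rewrite leqnn andbT; lia.
- by rewrite (@slope_0 1)// (@slope_1 2)// mulr0 add0r mulr1 mid ?s0.
- by rewrite (@slope_1 2)// (@slope_1 3)// !mulr1 subrK mid ?ler01 ?lexx.
- by rewrite (@slope_1 3)// (@slope_0 4)// mulr0 addr0 mulr1 mid//; lra.
- rewrite low//; have := @slope_le0 e.+4; have := @slope_le0 e.+4.+1.
  rewrite eN (ltnW eN) => /(_ isT) + /(_ isT); nra.
Qed.

Lemma ramp_continuous : continuous ramp.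
Proof.
have sc : continuous slope.
  move=> p; rewrite /slope; apply: cvgMl; apply: cvgB; last exact: cvg_cst.
  by apply: cvgD; apply: cvgMl; [exact: cvg_fst|exact: cvg_snd].
move=> p; apply: (@continuous_max R _ (fun=> 0) (fun q => Num.min 1 (slope q)) p).
  exact: cvg_cst.
by apply: (@continuous_min R _ (fun=> 1) slope p); [exact: cvg_cst|exact: sc].
Qed.

Lemma ramp_glue (y z : set_type (polygon R g)) : glue_gen y z ->
  exists k : int, ramp (set_val y) = ramp (set_val z) + k%:~R.
Proof.
move=> /(glue_genE g_pos)[e [s [eN s01 -> ->]]].
have s01' : 0 <= 1 - s <= 1 by lra.
have := ramp_edge s01' (mate_lt g_pos eN); rewrite subKr => ->; rewrite (ramp_edge s01 eN).
rewrite /mate; case: e {eN} => [|[|[|[|e]]]] /=.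
- by exists (-1); rewrite intrN; ring.
- by exists 0; ring.
- by exists 1; ring.
- by exists 0; ring.
- exists 0; rewrite addr0.
  case: ifP => [|]; first by rewrite addn2.
  by case: e => [|[|e]]; rewrite ?modnn.
Qed.

(** Read off a chosen representative, so it may jump by integers; periodic functions of it remain
    continuous. *)
Definition circle_lift (x : Sg R g) : R := ramp (set_val (repr x)).

Lemma ramp_rst (y z : set_type (polygon R g)) :
  Relation_Operators.clos_refl_sym_trans _ (@glue_gen R g) y z ->
  exists k : int, ramp (set_val y) = ramp (set_val z) + k%:~R.
Proof.
move=> yz; elim: yz => {y z}.
- exact: ramp_glue.
- by move=> y; exists 0; rewrite addr0.
- by move=> y z _ [k ->]; exists (- k); rewrite intrN addrK.
- by move=> y w z _ [k ->] _ [l ->]; exists (l + k); rewrite intrD addrA.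
Qed.

Lemma circle_lift_proj p : polygon R g p ->
  exists k : int, ramp p = circle_lift (proj g_pos p) + k%:~R.
Proof.
move=> pp; rewrite -[p in ramp p](val_insubd_polygon g_pos pp).
apply/ramp_rst/asboolP/(@eqmodP _ (glue_equiv R g)).
by rewrite reprK.
Qed.

Lemma circle_lift_continuous (h : R -> R) : continuous h ->
  (forall r (k : int), h (r + k%:~R) = h r) ->
  continuous (fun x => h (circle_lift x)).
Proof.
move=> hc hper.
apply: (@repr_comp_continuous _ _ _ (fun y : set_type (polygon R g) => h (ramp (set_val y)))).
  move=> y; apply: (@continuous_comp _ _ _ set_val (h \o ramp)).
    exact: (@initial_continuous (set_type (polygon R g)) _ set_val).
  by apply: continuous_comp; [exact: ramp_continuous|exact: hc].
move=> y z /eqP/(@eqmodP _ (glue_equiv R g))/asboolP/ramp_rst[k ->].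
by rewrite hper.
Qed.

(** [ramp \o p] is a continuous lift of the image of the path in [R/Z], so different end values mean
    a nonzero degree. *)
Lemma proj_path_essential (p : R -> R * R) :
  (forall s, s \in `[0, 1] -> polygon R g (p s)) ->
  {within `[0, 1], continuous (ramp \o p)} -> ramp (p 1) != ramp (p 0) ->
  ~ null_homotopic R (Sg R g) (proj g_pos \o p).
Proof.
move=> pp pc p10.
have cos_per r (k : int) : cos (2 * pi * (r + k%:~R)) = cos (2 * pi * r) :> R.
  by have [] := cos_sin_int r k.
have sin_per r (k : int) : sin (2 * pi * (r + k%:~R)) = sin (2 * pi * r) :> R.
  by have [] := cos_sin_int r k.
have lin : continuous (fun r : R => 2 * pi * r).
  by move=> r; apply: cvgMr; exact: cvg_id.
have cosc : continuous (fun r : R => cos (2 * pi * r)).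
  by move=> r; apply: continuous_comp; [exact: lin|exact: continuous_cos].
have sinc : continuous (fun r : R => sin (2 * pi * r)).
  by move=> r; apply: continuous_comp; [exact: lin|exact: continuous_sin].
apply: (not_null_homotopic_lift (circle_lift_continuous cosc cos_per)
  (circle_lift_continuous sinc sin_per) pc) => //.
by move=> s s01; exact: circle_lift_proj (pp s s01).
Qed.
End CircleMap.

(** * Curves made of straight pieces *)

Section Concat.
Variable R : realType.

Lemma within_continuous_comp_in (S T U : topologicalType) (A : set S) (B : set T)
  (h : S -> T) (k : T -> U) : (forall x, A x -> B (h x)) ->
  {within A, continuous h} -> {within B, continuous k} ->
  {within A, continuous (k \o h)}.
Proof.
move=> AB /subspace_continuousP hc /subspace_continuousP kc.
apply/subspace_continuousP => x Ax W /(kc _ (AB _ Ax)).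
rewrite /within /nbhs /= => /(hc _ Ax).
rewrite /within /nbhs /=; apply: filterS => y + Ay; apply => //; exact: AB.
Qed.

(** Piece [m] fills the [m]-th of [n.+1] equal time intervals; [minn] matters at time 1 only, where
    the truncation is [n.+1]. *)
Definition concat (Y : Type) n (h : nat -> R -> Y) (t : R) : Y :=
  let m := minn (Num.truncn (n.+1%:R * t)) n in h m (n.+1%:R * t - m%:R).

Variables (n : nat).
Local Notation time m u := ((m%:R + u) / n.+1%:R).

Lemma concatE (Y : Type) (h : nat -> R -> Y) m u : (m <= n)%N -> 0 <= u < 1 ->
  concat n h (time m u) = h m u.
Proof.
move=> mn /andP[u0 u1]; rewrite /concat mulrC divfK ?pnatr_eq0//.
rewrite (@truncn_def _ _ m); last by rewrite -natr1; apply/andP; split; lra.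
by rewrite (minn_idPl mn) addrC addKr.
Qed.

Lemma concat1 (Y : Type) (h : nat -> R -> Y) : concat n h 1 = h n 1.
Proof.
rewrite /concat mulr1 natrK (minn_idPr (leqnSn n)); congr (h _ _).
by rewrite -natr1 addrC addKr.
Qed.

Lemma concat0 (Y : Type) (h : nat -> R -> Y) : concat n h 0 = h 0%N 0.
Proof. by rewrite -[RHS](concatE h (leq0n n)) ?addr0 ?mul0r// lexx ltr01. Qed.

Lemma time_inv (t : R) : 0 <= t < 1 ->
  exists m u, [/\ (m <= n)%N, 0 <= u < 1 & t = time m u].
Proof.
move=> /andP[t0 t1]; set T := n.+1%:R * t.
have T0 : 0 <= T by rewrite mulr_ge0.
have /andP[Tm TM] := truncn_itv T0.
exists (Num.truncn T), (T - (Num.truncn T)%:R); split.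
- by rewrite -ltnS truncn_lt_nat// gtr_pMr// ltr0n.
- by move: TM; rewrite -natr1; lra.
- by rewrite [_ + (T - _)]addrC subrK /T mulrAC divff ?mul1r ?pnatr_eq0.
Qed.

Lemma concat_continuous (Y : topologicalType) (h : nat -> R -> Y) :
  (forall m, (m <= n)%N -> {within `[0, 1], continuous (h m)}) ->
  (forall m, (m < n)%N -> h m 1 = h m.+1 0) ->
  {within `[0, 1], continuous (concat n h)}.
Proof.
move=> hc hS.
pose k T : Y := let m := minn (Num.truncn T) n in h m (T - m%:R).
have kc m : (m <= n)%N -> {within `[m%:R, m.+1%:R], continuous k}.
  move=> mn; apply: (@subspace_eq_continuous _ _ _ (h m \o (fun T => T - m%:R))).
    move=> T; rewrite inE /= in_itv/= => /andP[T1 T2].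
    change (h m (T - m%:R) = k T); rewrite /k.
    (* At the right end of the interval the truncation already selects the next piece, which starts
       where this one ends; for the last piece [minn] prevents this. *)
    move: T2; rewrite le_eqVlt => /orP[/eqP->|T2].
      have e1 j : j.+1%:R - j%:R = 1 :> R by rewrite -natr1 addrC addKr.
      rewrite natrK e1.
      move: mn; rewrite leq_eqVlt => /orP[/eqP->|mn].
        by rewrite (minn_idPr (leqnSn n)) e1.
      by rewrite (minn_idPl mn) subrr hS.
    by rewrite (@truncn_def _ _ m) ?T1// (minn_idPl mn).
  have : {within `[m%:R, m.+1%:R], continuous (h m \o (fun T => T - m%:R))}; last by [].
  apply: (@within_continuous_comp_in _ _ _ _ `[0:R, 1]%classic).
  - by move=> T /=; rewrite !in_itv/= -natr1 => /andP[T1 T2]; apply/andP; split; lra.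
  - apply: continuous_subspaceT => T.
    by apply: cvgB; [exact: cvg_id|exact: cvg_cst].
  - exact: hc.
have kcc m : (m <= n)%N -> {within `[0, m.+1%:R], continuous k}.
  elim: m => [mn|m IH mn]; first exact: kc mn.
  have -> : `[0, m.+2%:R]%classic =
      `[0, m.+1%:R]%classic `|` `[m.+1%:R, m.+2%:R]%classic :> set R.
    apply/seteqP; split => T /=; rewrite !in_itv/=.
      by move=> /andP[T0 T1]; case: (lerP T m.+1%:R) => T2; [left|right];
        rewrite ?T0 ?T2//= ltW.
    have m1 : (0 : R) <= m.+1%:R by rewrite ler0n.
    have m2 : m.+1%:R <= m.+2%:R :> R by rewrite ler_nat.
    by case=> /andP[T0 T1]; apply/andP; split; lra.
  apply: withinU_continuous; [exact: interval_closed|exact: interval_closed| |].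
    exact: IH (ltnW mn).
  exact: kc.
have -> : concat n h = k \o (fun t => n.+1%:R * t) by [].
apply: (@within_continuous_comp_in _ _ _ _ `[0:R, n.+1%:R]%classic).
- move=> t /=; rewrite !in_itv/= => /andP[t0 t1].
  by rewrite mulr_ge0//= ger_pMr ?ltr0n.
- by apply: continuous_subspaceT => t; apply: cvgMr; exact: cvg_id.
- exact: kcc.
Qed.

Lemma concat_simple_closed (Y : topologicalType) (h : nat -> R -> Y) :
  (forall m, (m <= n)%N -> {within `[0, 1], continuous (h m)}) ->
  (forall m, (m < n)%N -> h m 1 = h m.+1 0) -> h n 1 = h 0%N 0 ->
  (forall m m' u u', (m <= n)%N -> (m' <= n)%N -> 0 <= u < 1 -> 0 <= u' < 1 ->
    h m u = h m' u' -> m = m' /\ u = u') ->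
  simple_closed_param R Y (concat n h)
    [set x | exists m u, [/\ (m <= n)%N, 0 <= u < 1 & x = h m u]].
Proof.
move=> hc hS hn hinj.
have c01 : concat n h 0 = concat n h 1 by rewrite concat0 concat1.
split; first exact: concat_continuous.
split; first exact: c01.
split.
  move=> s t; rewrite !in_itv/= => /time_inv[m [u [mn u01 ->]]].
  move=> /time_inv[m' [u' [mn' u01' ->]]].
  by rewrite !concatE// => /hinj[]// -> ->.
apply/seteqP; split => x /=.
  move=> [m [u [mn u01 ->]]]; exists (time m u); last exact: concatE.
  rewrite /= in_itv/= ler_pdivrMr ?ltr0n// mul1r divr_ge0//=; last first.
    by rewrite addr_ge0//; case/andP: u01.
  have : m%:R <= n%:R :> R by rewrite ler_nat.
  by rewrite -natr1; lra.
move=> [t]; rewrite /= in_itv/= => /andP[t0 t1] <-.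
have [m [u [mn u01 hmu]]] : exists m u,
    [/\ (m <= n)%N, 0 <= u < 1 & concat n h t = h m u].
  (* As pieces are half-open, the point at time 1 is counted as the start of the first piece. *)
  move: t1; rewrite le_eqVlt => /orP[/eqP->|t1].
    by exists 0%N, 0; rewrite -c01 concat0 lexx ltr01.
  have [|m [u [mn u01 ->]]] := @time_inv t; first by rewrite t0.
  by exists m, u; rewrite concatE.
by exists m, u.
Qed.
End Concat.

(** * Simple closed curves from segments in the triangles *)

Section Pieces.
Variables (R : realType) (g : nat).
Hypothesis g_pos : (0 < g)%N.
Local Notation N := (4 * g)%N.
Local Notation proj := (proj g_pos).

(* A piece ((e, left), (c, c')) is the segment from c to c' in the triangle e; the
   flag tells on which side of the bisector b = a of the triangle it lies. *)
Definition piece : Type := ((nat * bool) * ((R * R) * (R * R)))%type.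

Definition bary (p : piece) (u : R) : R * R :=
  ((1 - u) * p.2.1.1 + u * p.2.2.1, (1 - u) * p.2.1.2 + u * p.2.2.2).

Definition plane (p : piece) (u : R) : R * R :=
  sector g p.1.1 (bary p u).1 (bary p u).2.

Definition in_triangle (c : R * R) := [&& 0 <= c.1, 0 <= c.2 & c.1 + c.2 <= 1].

(** The last condition spares the end [u = 1], which may lie on a ray or on the bisector. It makes
    the coordinates of a point determine the half triangle. *)
Definition wf_piece (p : piece) := [/\ (p.1.1 < N)%N, in_triangle p.2.1,
  in_triangle p.2.2, p.2.1 != p.2.2 &
  forall u, 0 <= u < 1 -> 0 < (bary p u).1 < 1 /\
    p.1.2 = ((bary p u).2 < (bary p u).1)].

(** Besides meeting on the surface, the pieces must agree in [ramp], so that the lift along the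
    curve has no jump. *)
Definition linked (p q : piece) := `[< proj (plane p 1) = proj (plane q 0) /\
  ramp g (plane p 1) = ramp g (plane q 0) >].

Lemma coord_triangle p u : wf_piece p -> 0 <= u <= 1 -> in_triangle (bary p u).
Proof.
move=> [_ /and3P[a0 b0 ab] /and3P[a'0 b'0 ab'] _ _] /andP[u0 u1].
by apply/and3P; split; rewrite /bary /=; nra.
Qed.

Lemma coord_inj p u u' : wf_piece p -> bary p u = bary p u' -> u = u'.
Proof.
move=> [_ _ _ + _]; case: p => [k [[a b] [a' b']]] /=; rewrite /bary /= => st [e1 e2].
apply/eqP; apply: contraNT st => uu'.
have u0 : u - u' != 0 by rewrite subr_eq0.
apply/eqP; congr (_, _); apply: (mulfI u0); lra.
Qed.

Lemma plane_polygon p u : wf_piece p -> 0 <= u <= 1 -> polygon R g (plane p u).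
Proof.
move=> wp u01; have /and3P[a0 b0 ab] := coord_triangle wp u01.
by case: wp => pN *; exact: polygon_sector.
Qed.

Lemma proj_plane_eq p q u v : wf_piece p -> wf_piece q -> 0 <= u < 1 -> 0 <= v < 1 ->
  proj (plane p u) = proj (plane q v) ->
  (p.1 = q.1 /\ bary p u = bary q v) \/
  [/\ q.1.1 = mate p.1.1, (bary p u).1 + (bary p u).2 = 1 &
      bary q v = ((bary p u).2, (bary p u).1)].
Proof.
move=> wp wq u01 v01 puv.
have u01' : 0 <= u <= 1 by case/andP: u01 => -> /ltW.
have v01' : 0 <= v <= 1 by case/andP: v01 => -> /ltW.
have /and3P[a0 b0 ab] := coord_triangle wp u01'.
have /and3P[a'0 b'0 ab'] := coord_triangle wq v01'.
case: (wp) (wq) => pN _ _ _ /(_ u u01)[a01 sp] [qN _ _ _ /(_ v v01)[a'01 sq]].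
have [[e1 e2 e3]|[e1 e2 e3 e4]] := proj_sector_inj pN qN a01 b0 ab a'01 b'0 ab' puv.
  left; split; last by rewrite [LHS]surjective_pairing e2 e3 -surjective_pairing.
  by rewrite [LHS]surjective_pairing e1 sp e2 e3 -sq -surjective_pairing.
by right; split => //; rewrite [LHS]surjective_pairing e3 e4.
Qed.

Lemma plane_continuous p : continuous (plane p).
Proof.
have cc : continuous (fun u => (bary p u).1) /\ continuous (fun u => (bary p u).2).
  by split => u; apply: cvgD; apply: cvgMl => //; try (by apply: cvg_id);
    apply: cvgB; [exact: cvg_cst|exact: cvg_id|exact: cvg_cst|exact: cvg_id].
have lc x y : continuous (fun u => (bary p u).1 * x + (bary p u).2 * y).
  by move=> u; apply: cvgD; apply: cvgMl; [exact: cc.1|exact: cc.2].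
by move=> u; exact: (cvg_pair (lc _ _ u) (lc _ _ u)).
Qed.

Definition curve (l : seq piece) : set (Sg R g) :=
  [set x | exists p u, [/\ p \in l, 0 <= u < 1 & x = proj (plane p u)]].

(** Distinct keys put the pieces in different half triangles, so they could meet only across a glued
    edge, which the third hypothesis forbids. The closing point matches on the surface but not in
    [ramp], giving a nonzero degree. *)
Lemma pieces_essential (p0 : piece) (l : seq piece) :
  {in p0 :: l, forall p, wf_piece p} -> uniq (map fst (p0 :: l)) ->
  {in p0 :: l &, forall p q, q.1.1 = mate p.1.1 -> forall u v,
    0 <= u < 1 -> 0 <= v < 1 -> (bary p u).1 + (bary p u).2 = 1 ->
    bary q v != ((bary p u).2, (bary p u).1)} ->
  path linked p0 l ->
  proj (plane (last p0 l) 1) = proj (plane p0 0) ->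
  ramp g (plane (last p0 l) 1) != ramp g (plane p0 0) ->
  essential_curve R (Sg R g) (curve (p0 :: l)).
Proof.
move=> wl ul gl pl cl rl.
set L := p0 :: l; set n := size l.
pose h m := plane (nth p0 L m).
have hL m : (m <= n)%N -> nth p0 L m \in L by move=> mn; apply: mem_nth.
have hwf m : (m <= n)%N -> wf_piece (nth p0 L m) by move=> /hL/wl.
have hn : nth p0 L n = last p0 l by rewrite [RHS](last_nth p0).
have hlink m : (m < n)%N -> linked (nth p0 L m) (nth p0 L m.+1).
  by move=> mn; have /(pathP p0)/(_ m mn) := pl.
exists (concat n (fun m => proj \o h m)); split.
  have -> : curve L = [set x | exists m u,
      [/\ (m <= n)%N, 0 <= u < 1 & x = (proj \o h m) u]].
    apply/seteqP; split => x /=.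
      move=> [p [u [pL u01 ->]]]; exists (index p L), u.
      by rewrite -ltnS -[n.+1]/(size L) index_mem pL /h nth_index.
    by move=> [m [u [mn u01 ->]]]; exists (nth p0 L m), u; split => //; exact: hL.
  apply: concat_simple_closed.
  - move=> m mn; apply: (@within_continuous_comp_in _ _ _ _ (polygon R g)).
    + by move=> u; rewrite /= in_itv/=; exact/plane_polygon/hwf.
    + by apply: continuous_subspaceT; exact: plane_continuous.
    + exact: proj_continuous.
  - by move=> m mn; have /asboolP[] := hlink m mn.
  - by rewrite /= /h hn.
  - move=> m m' u u' mn mn' u01 u01' /= /(proj_plane_eq (hwf _ mn) (hwf _ mn') u01 u01').
    case=> [[k1 c1]|[k1 c1 c2]].
      have mm' : m = m'.
        have sL : size (map fst L) = n.+1 by rewrite size_map.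
        apply/eqP; rewrite -(nth_uniq p0.1 _ _ ul) ?sL//.
        by rewrite !(nth_map p0) ?k1.
      split => //; move: c1; rewrite -mm'; exact/coord_inj/hwf.
    by have := gl _ _ (hL _ mn) (hL _ mn') k1 _ _ u01 u01' c1; rewrite c2 eqxx.
have hp s : s \in `[0, 1] -> polygon R g (concat n h s).
  rewrite in_itv/= => /andP[s0]; rewrite le_eqVlt => /orP[/eqP->|s1].
    by rewrite concat1; apply: plane_polygon; rewrite ?ler01 ?lexx//; exact: hwf.
  have [|m [u [mn /andP[u0 u1] ->]]] := @time_inv _ n s; first by rewrite s0.
  rewrite concatE ?u0//; apply: plane_polygon; first exact: hwf.
  by rewrite u0 ltW.
apply: (@proj_path_essential _ _ g_pos (concat n h)) => //; last first.
  by rewrite concat1 concat0 /h hn.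
apply: (@concat_continuous _ n _ (fun m => ramp g \o h m)).
  move=> m mn; apply: continuous_subspaceT => u.
  by apply: continuous_comp; [exact: plane_continuous|exact: ramp_continuous].
by move=> m mn; have /asboolP[] := hlink m mn.
Qed.
End Pieces.

(** * Strands *)

Section Strands.
Variables (R : realType) (g : nat).
Hypothesis g_pos : (0 < g)%N.
Local Notation N := (4 * g)%N.
Local Notation proj := (proj g_pos).

(** [D p q] prescribes, for [p < q], that the strands be disjoint. [d] is the usual depth; [x] and
    [y] are the depths at the two places of the first handle where consecutive strands may be made
    to meet. *)
Variables (d x y : nat -> R) (D : nat -> nat -> bool) (pr : nat -> nat * nat).
Hypothesis d_gt0 : forall q, 0 < d q.
Hypothesis d_lt : forall q, d q < 1 / 2.
Hypothesis d_mono : forall p q, (p < q)%N -> d p < d q.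
Hypothesis x_gt0 : forall q, 0 < x q.
Hypothesis x_lt : forall q, x q < 1 / 2.
Hypothesis y_gt0 : forall q, 0 < y q.
Hypothesis y_lt : forall q, y q < 1 / 2.

(* In the triangle e, strand q either cuts corners of the polygon (running from
   the boundary to a neighbouring ray) or follows the edge from ray to ray;
   pr k is the pair of strands attached to the handle k >= 1. *)
Definition corner (q e : nat) : bool :=
  if (e < 4)%N then e != 3
  else (q < (pr (e %/ 4)).1)%N || ((q < (pr (e %/ 4)).2)%N && (e %% 4 != 3)%N).

(** Strand [i] is pulled to the midpoint of edge 3 of the handle and [j] to that of edge 1, which is
    glued to it. The test [i < j] switches off handles without a pair. *)
Definition touch (q e : nat) : bool :=
  let: (i, j) := pr (e %/ 4) in
  [&& (4 <= e)%N, (i < j)%N, ~~ D i j &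
      (e %% 4 == 3)%N && (q == i) || (e %% 4 == 1)%N && (q == j)].

(* Depth of strand q below the boundary at the ray through a vertex of the
   triangle e, and at its bisector. *)
Definition xlev (q e : nat) : R := if (e < 4)%N then x q else d q.

Definition ylev (q e : nat) : R :=
  if (e < 4)%N then y q else if touch q e then 0 else d q.

Definition mid (z : R) : R * R := ((1 - z) / 2, (1 - z) / 2).

Definition ends (q : nat) (key : nat * bool) : (R * R) * (R * R) :=
  let: (e, s) := key in
  match s, corner q e with
  | true, true => ((1 - d q, 0), (1 - d q, d q))
  | true, false => ((1 - xlev q e, 0), mid (ylev q e))
  | false, true => ((d q, 1 - d q), (0, 1 - xlev q e))
  | false, false => (mid (ylev q e), (0, 1 - d q))
  end.

Definition piece_of q key : piece R := (key, ends q key).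

(* The pieces of strand q in the handle k, in order of traversal. The first case
   is the walk around all four corners; it crosses a, b^-1, a^-1, b in turn. *)
Definition tile_pattern (q k : nat) : seq (nat * bool) :=
  if (q < (pr k).1)%N then
    [:: (0, true); (2, false); (3, true); (1, false);
        (2, true); (0, false); (1, true); (3, false)]
  else if (q < (pr k).2)%N then
    [:: (0, true); (2, false); (3, true); (3, false)]
  else
    [:: (0, true); (0, false); (1, true); (1, false);
        (2, true); (2, false); (3, true); (3, false)].

Definition tile_keys (q k : nat) : seq (nat * bool) :=
  [seq ((4 * k + c.1)%N, c.2) | c <- tile_pattern q k].

(** In the first handle only [a_1] is crossed: a strand enters through the edge 2 by [(2, false)],
    prepended in [strand], follows the edge 3, passes the other handles and leaves through the edge
    0. *)
Definition strand_keys q : seq (nat * bool) :=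
  [:: (3, true); (3, false)]
    ++ flatten [seq tile_keys q k | k <- iota 1 g.-1] ++ [:: (0, true)].

Definition strand q : set (Sg R g) :=
  curve g_pos (map (piece_of q) ((2, false) :: strand_keys q)).

Lemma xlev_bounds q e : 0 < xlev q e < 1 / 2.
Proof. by rewrite /xlev; case: ifP; rewrite ?x_gt0 ?x_lt ?d_gt0 ?d_lt. Qed.

Lemma ylev_bounds q e : 0 <= ylev q e < 1 / 2.
Proof.
rewrite /ylev; case: ifP => _; first by rewrite ltW//= y_lt.
by case: ifP => _; [lra|rewrite ltW//= d_lt].
Qed.

Lemma piece_of_wf q key : (key.1 < N)%N -> wf_piece g (piece_of q key).
Proof.
case: key => e s /= eN.
rewrite /wf_piece /piece_of /= /bary /in_triangle /mid.
have := d_gt0 q; have := d_lt q; have /andP[] := xlev_bounds q e.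
have /andP[] := ylev_bounds q e.
move: (xlev q e) (ylev q e) => xx yy y0 y1 x0 x1 d1 d0.
case: s; case: (corner q e) => /=; split => //.
all: try by apply/and3P; split; lra.
all: try by (apply/eqP => -[]; lra).
all: move=> u /andP[u0 u1]; split; first by apply/andP; split; nra.
all: apply/esym; first [by apply/idP; nra | by apply/negbTE; rewrite -leNgt; nra].
Qed.

(* Pieces being parametrized by [0, 1[, only their starting point can be on the
   boundary. *)
Lemma boundary_start q e s u : 0 <= u < 1 ->
  (bary (piece_of q (e, s)) u).1 + (bary (piece_of q (e, s)) u).2 = 1 ->
  bary (piece_of q (e, s)) u = (d q, 1 - d q) \/
  bary (piece_of q (e, s)) u = (1 / 2, 1 / 2) /\ touch q e.
Proof.
move=> /andP[u0 u1].
have := d_gt0 q; have := d_lt q; have /andP[] := xlev_bounds q e.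
have /andP[] := ylev_bounds q e => y0 y1 x0 x1 d1 d0.
rewrite /bary /piece_of /= /mid; case: s; case: (corner q e) => /= sum1.
- exfalso; nra.
- exfalso; nra.
- have -> : u = 0 by nra.
  by left; congr (_, _); lra.
- have /eqP yy0 : ylev q e == 0.
    have : (1 - u) * ylev q e + u * d q = 0 by lra.
    move=> h; have : 0 <= (1 - u) * ylev q e by rewrite mulr_ge0//; lra.
    move=> h1; have u_0 : u = 0 by nra.
    by apply/eqP; rewrite -h u_0; ring.
  have -> : u = 0 by move: sum1; rewrite yy0; nra.
  rewrite yy0; right; split; first by congr (_, _); lra.
  move: yy0; rewrite /ylev; case: ifP => _; first by have := y_gt0 q; lra.
  by case: ifP => // _; lra.
Qed.

(** Edge 3 of a handle is reserved for [i] and edge 1 for [j], so touches on glued edges identify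
    the two strands as that pair. *)
Lemma touch_mate p q e : touch p e -> touch q (mate e) ->
  (p < q)%N && ~~ D p q || (q < p)%N && ~~ D q p.
Proof.
rewrite /touch; have -> : (mate e %/ 4 = e %/ 4)%N by rewrite /mate; case: ifP; lia.
case: (pr _) => i j /and4P[_ ij nD h1] /and4P[_ _ _ h2].
move: h1 h2; have [m1 m3] : (e %% 4 == 1 -> mate e %% 4 == 3)%N /\
    (e %% 4 == 3 -> mate e %% 4 == 1)%N.
  by rewrite /mate; split; case: ifP; lia.
case/orP => /andP[c /eqP->].
  by rewrite (eqP (m3 c)) /= => /eqP->; rewrite ij nD.
by rewrite (eqP (m1 c)) /= orbF => /eqP->; rewrite ij nD orbT.
Qed.

(** A piece starting at a crossing has first coordinate [d < 1 / 2] there; the swapped point has it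
    above 1/2, where no piece starts. Only midpoints survive the swap. *)
Lemma swapped_touch p q e s s' u v : 0 <= u < 1 -> 0 <= v < 1 ->
  (bary (piece_of p (e, s)) u).1 + (bary (piece_of p (e, s)) u).2 = 1 ->
  bary (piece_of q (mate e, s')) v =
    ((bary (piece_of p (e, s)) u).2, (bary (piece_of p (e, s)) u).1) ->
  touch p e /\ touch q (mate e).
Proof.
move=> u01 v01 sum1 swap.
have sum2 : (bary (piece_of q (mate e, s')) v).1 + (bary (piece_of q (mate e, s')) v).2 = 1.
  by rewrite swap /= addrC.
have := d_lt p; have := d_lt q; move: swap.
case: (boundary_start u01 sum1) => [->|[-> ?]];
  case: (boundary_start v01 sum2) => [->|[-> ?]] //= [] *; lra.
Qed.

(** * Nesting of two strands inside a triangle *)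

Section Disjoint.
Variables (p q : nat).
Hypotheses (pq : (p < q)%N) (xpq : x p < x q) (ypq : y p < y q).

Lemma corner_mono e : corner q e -> corner p e.
Proof.
rewrite /corner; case: ifP => // _.
case/orP => [h|/andP[h c]]; first by rewrite (ltn_trans pq h).
by rewrite (ltn_trans pq h) c orbT.
Qed.

Lemma xlev_mono e : xlev p e < xlev q e.
Proof. by rewrite /xlev; case: ifP => _ //; exact: d_mono. Qed.

(** The level of [q] drops to 0 only where [q] touches, and there every outer strand cuts the
    corners, contrary to the assumption on [p]. *)
Lemma ylev_mono e : ~~ corner p e -> ylev p e < ylev q e.
Proof.
rewrite /corner /ylev; case: ifP => // e4.
rewrite negb_or -!leqNgt negb_and -leqNgt negbK => /andP[ip cp].
have -> : touch q e = false.
  apply/negbTE; rewrite /touch; move: ip cp; case: (pr _) => i j /= ip cp.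
  apply/negP => /and4P[_ ij _ /orP[/andP[c /eqP qi]|/andP[/eqP c /eqP qj]]].
    by move: pq; rewrite qi ltnNge ip.
  by move: cp; rewrite c orbF leqNgt -qj pq.
by case: ifP => _; [exact: d_gt0|exact: d_mono].
Qed.

(** Two strands can differ in cutting corners only beyond the first handle, where the ray level is
    [d]. *)
Lemma xlev_corner e : corner p e -> ~~ corner q e -> xlev p e = d p.
Proof. by rewrite /corner /xlev; case: ifP => // _ ->. Qed.

(** Outer strands have smaller levels. Either one coordinate already separates the pieces, or the
    two coordinate equations order [u] and [v] in opposite ways. *)
Lemma coord_neq key u v : 0 <= u < 1 -> 0 <= v < 1 ->
  bary (piece_of p key) u != bary (piece_of q key) v.
Proof.
case: key => e s /andP[u0 u1] /andP[v0 v1]; apply/eqP.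
have := @corner_mono e; have := xlev_mono e; have := @ylev_mono e.
have := @xlev_corner e; have := d_mono pq.
have := d_gt0 p; have := d_lt q.
have /andP[] := xlev_bounds p e; have /andP[] := xlev_bounds q e.
have /andP[] := ylev_bounds p e; have /andP[] := ylev_bounds q e.
rewrite /bary /piece_of /= /mid.
move: (xlev p e) (xlev q e) (ylev p e) (ylev q e) (d p) (d q).
move=> x1 x2 y1 y2 d1 d2 y20 y21 y10 y11 x20 x21 x10 x11 d2' d1' d12.
have v1' : 0 < 1 - v by lra.
case: s; case: (corner p e); case: (corner q e) => /= xc yl x12 cc [].
- by move=> h _; lra.
- move=> h _; nra.
- by have := cc isT.
- have {}yl := yl isT.
  move=> h1 h2.
  have e1 : (1 - u) * (1 - x1) = (1 - v) * (1 - x2) by lra.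
  have e2 : u * (1 - y1) = v * (1 - y2) by lra.
  have uv : u <= v by nra.
  nra.
- move=> h1 h2.
  have e1 : (1 - u) * d1 = (1 - v) * d2 by lra.
  have e2 : u * x1 = v * x2 by lra.
  have uv : u < v by nra.
  nra.
- have -> := xc isT isT.
  move=> h1 h2; nra.
- by have := cc isT.
- have {}yl := yl isT.
  move=> h1 h2.
  have e1 : (1 - u) * (1 - y1) = (1 - v) * (1 - y2) by lra.
  have e2 : u * (1 - d1) = v * (1 - d2) by lra.
  have uv : v < u by nra.
  nra.
Qed.
End Disjoint.

Lemma tile_pattern_lt q k c : c \in tile_pattern q k -> (c.1 < 4)%N.
Proof.
move: c; apply/allP; rewrite /tile_pattern.
by case: ifP => _ //; case: ifP.
Qed.

Lemma tile_pattern_uniq q k : uniq (tile_pattern q k).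
Proof. by rewrite /tile_pattern; case: ifP => _ //; case: ifP. Qed.

Lemma tile_keys_div q k key : key \in tile_keys q k -> (key.1 %/ 4)%N = k.
Proof.
move=> /mapP[c /tile_pattern_lt c4 ->] /=.
by rewrite mulnC divnMDl// divn_small// addn0.
Qed.

Lemma strand_keysP q key : key \in (2, false) :: strand_keys q ->
  [\/ key \in [:: (2, false); (3, true); (3, false); (0, true)] |
      exists2 k, (1 <= k < g)%N & key \in tile_keys q k].
Proof.
rewrite /strand_keys inE !mem_cat => /or4P[h|h|h|h].
- by left; rewrite inE h.
- by left; move: h; rewrite !inE => /orP[]->; rewrite ?orbT.
- right; have /flatten_mapP[k] := h; rewrite mem_iota => kg kk.
  by exists k => //; move: kg; case: (g) g_pos.
- by left; move: h; rewrite !inE => ->; rewrite !orbT.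
Qed.

Lemma strand_keys_lt q key : key \in (2, false) :: strand_keys q -> (key.1 < N)%N.
Proof.
move=> /strand_keysP[|[k /andP[_ kg] /tile_keys_div h]].
  have g4 : (4 <= N)%N by rewrite leq_pmulr.
  by rewrite !inE => /or4P[] /eqP-> /=; apply: leq_trans g4.
by rewrite mulnC -ltn_divLR// h.
Qed.

Lemma strand_keys_uniq q : uniq ((2, false) :: strand_keys q).
Proof.
have tile_uniq k : uniq (tile_keys q k).
  rewrite map_inj_uniq ?tile_pattern_uniq// => -[c b] [c' b'] /= [/addnI-> ->] //.
have body h : forall k, uniq (flatten [seq tile_keys q j | j <- iota k h]) /\
    {in flatten [seq tile_keys q j | j <- iota k h], forall key, (k <= key.1 %/ 4)%N}.
  elim: h => // h IH k; have [u1 u2] := IH k.+1; split.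
    rewrite /= cat_uniq tile_uniq u1 andbT /=; apply/hasPn => key /u2 kk.
    by apply/negP => /tile_keys_div hk; rewrite hk ltnn in kk.
  move=> key; rewrite /= mem_cat => /orP[/tile_keys_div->//|/u2]; exact: ltnW.
have [u1 u2] := body g.-1 1%N.
have low key : (key.1 %/ 4)%N = 0%N ->
    key \notin flatten [seq tile_keys q j | j <- iota 1 g.-1].
  by move=> k0; apply/negP => /u2; rewrite k0.
rewrite /strand_keys /= !inE !mem_cat !inE (negbTE (low (2, false) erefl)).
rewrite (negbTE (low (3, true) erefl)) (negbTE (low (3, false) erefl)) /=.
by rewrite cat_uniq u1 /= orbF low.
Qed.

Lemma strand_mem q x0 : strand q x0 -> exists key u,
  [/\ key \in (2, false) :: strand_keys q, 0 <= u < 1 & x0 = proj (plane g (piece_of q key) u)].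
Proof.
by move=> [p [u [/mapP[key kq ->] u01 ->]]]; exists key, u.
Qed.

Lemma mem_strand q key u : key \in (2, false) :: strand_keys q -> 0 <= u < 1 ->
  strand q (proj (plane g (piece_of q key) u)).
Proof. by move=> kq u01; exists (piece_of q key), u; split => //; exact: map_f. Qed.

Lemma strand_wf q : {in map (piece_of q) ((2, false) :: strand_keys q),
  forall p, wf_piece g p}.
Proof. by move=> p /mapP[key kq ->]; apply/piece_of_wf/(strand_keys_lt kq). Qed.

Lemma strand_disjoint p q : (p < q)%N -> D p q -> x p < x q -> y p < y q ->
  strand p `&` strand q = set0.
Proof.
move=> pq Dpq xpq ypq; apply/seteqP; split => // z [].
move=> /strand_mem[kp [u [kpS u01 ->]]] /strand_mem[kq [v [kqS v01 puv]]].
have wp := piece_of_wf p (strand_keys_lt kpS).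
have wq := piece_of_wf q (strand_keys_lt kqS).
have [[/= k1 c1]|[/= k1 c1 c2]] := proj_plane_eq wp wq u01 v01 puv.
  by move: c1; rewrite k1 => /eqP; apply/negP; exact: coord_neq.
move: c1 c2; rewrite (surjective_pairing kq) k1 (surjective_pairing kp) /=.
move=> c1 c2; have [t1 t2] := swapped_touch u01 v01 c1 c2.
have := touch_mate t1 t2; rewrite pq Dpq /= => /andP[qp _].
by have := ltn_trans pq qp; rewrite ltnn.
Qed.

(** The start of strand [p] on the edge 2 sits at [d p]; a strand through this point must start a
    piece there, and its own [d] is then the same. *)
Lemma strand_neq p q : p != q -> strand p <> strand q.
Proof.
move=> pq pqE; have u01 : 0 <= (0 : R) < 1 by rewrite lexx ltr01.
have kpS r : (2, false) \in (2, false) :: strand_keys r by rewrite inE eqxx.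
have := @mem_strand p (2, false) 0 (kpS p) u01; rewrite {}pqE.
move=> /strand_mem[kq [v [kqS v01 puv]]].
have wp := piece_of_wf p (strand_keys_lt (kpS p)).
have wq := piece_of_wf q (strand_keys_lt kqS).
have cp : bary (piece_of p (2, false)) 0 = (d p, 1 - d p).
  by rewrite /bary /piece_of /=; congr (_, _); ring.
have := d_lt p; have := d_lt q.
have [[/= k1 c1]|[_ _ c2]] := proj_plane_eq wp wq u01 v01 puv.
  move: c1; rewrite -k1 cp => c1.
  have sum1 : (bary (piece_of q (2, false)) v).1 + (bary (piece_of q (2, false)) v).2 = 1.
    by rewrite -c1 /=; ring.
  have [|[]] := boundary_start v01 sum1; rewrite -c1 => -[]; last by move=> *; lra.
  by move=> dpq _; move: pq; rewrite neq_ltn => /orP[] /d_mono; rewrite dpq ltxx.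
have sum2 : (bary (piece_of q (kq.1, kq.2)) v).1 + (bary (piece_of q (kq.1, kq.2)) v).2 = 1.
  by rewrite -surjective_pairing c2 cp /=; ring.
by have [|[]] := boundary_start v01 sum2; rewrite -surjective_pairing c2 cp /= => -[] *; lra.
Qed.

(** * Linking the pieces of a strand into a closed curve *)

Lemma plane_start q e s :
  plane g (piece_of q (e, s)) 0 = sector g e (ends q (e, s)).1.1 (ends q (e, s)).1.2.
Proof. by rewrite /plane /bary subr0 !mul1r !mul0r !addr0. Qed.

Lemma plane_end q e s :
  plane g (piece_of q (e, s)) 1 = sector g e (ends q (e, s)).2.1 (ends q (e, s)).2.2.
Proof. by rewrite /plane /bary subrr !mul1r !mul0r !add0r. Qed.

Definition link q (k1 k2 : nat * bool) := linked g_pos (piece_of q k1) (piece_of q k2).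

Lemma link_eq q k1 k2 : plane g (piece_of q k1) 1 = plane g (piece_of q k2) 0 ->
  link q k1 k2.
Proof. by move=> h; apply/asboolP; rewrite h. Qed.

Lemma link_mid q e : ~~ corner q e -> link q (e, true) (e, false).
Proof.
by move=> c; apply: link_eq; rewrite plane_end plane_start /= (negbTE c).
Qed.

(** The bound leaves out the first rays of the first handle: no strand crosses them, and the levels
    [x] and [d] on their two sides need not match. *)
Lemma link_ray q e : (2 <= e)%N -> link q (e, false) (e.+1, true).
Proof.
move=> e2; apply: link_eq; rewrite plane_end plane_start.
have -> : (ends q (e.+1, true)).1 = ((ends q (e, false)).2.2, 0).
  case: (ltnP 3 e) e2 => [e4 _|].
    have h1 : (e.+1 < 4)%N = false by apply/negbTE; lia.
    have h2 : (e < 4)%N = false by apply/negbTE; lia.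
    by rewrite /ends /xlev h1 h2; do 2 case: (corner _ _).
  move=> e3 e2; have [->|->] : e = 2%N \/ e = 3%N by lia.
    by rewrite /ends /corner /xlev.
  by rewrite /ends /corner /xlev /=; case: (_ || _).
have -> : (ends q (e, false)).2.1 = 0 by rewrite /=; case: (corner _ _).
by rewrite /sector /=; congr (_, _); ring.
Qed.

Lemma link_last q : link q (N.-1, false) (0%N, true).
Proof.
apply: link_eq; rewrite plane_end plane_start.
have N4 : (4 <= N)%N by rewrite leq_pmulr.
have -> : (ends q (0%N, true)).1 = ((ends q (N.-1, false)).2.2, 0).
  have : (3 <= N.-1)%N by rewrite -ltnS prednK// (leq_trans _ N4).
  case: (ltngtP 3 N.-1) => // [e4 _|<- _]; last by rewrite /ends /corner.
  by rewrite /ends /xlev [(N.-1 < 4)%N]ltnNge e4 /=; case: (corner _ _).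
have -> : (ends q (N.-1, false)).2.1 = 0 by rewrite /=; case: (corner _ _).
have VN : pvert R g N.-1.+1 = pvert R g 0 by rewrite prednK ?(leq_trans _ N4)// pvertN.
rewrite /sector VN; move: (pvert R g N.-1) (ends q (N.-1, false)).2.2 => v r.
by congr (_, _); rewrite /=; ring.
Qed.

(** [ramp] vanishes on all edges from 4 on, so these crossings cause no jump. *)
Lemma link_glue q e : (4 <= e < N)%N -> corner q e -> corner q (mate e) ->
  link q (e, true) (mate e, false).
Proof.
move=> /andP[e4 eN] ce cm; apply/asboolP; rewrite plane_end plane_start /= ce cm /=.
have d01 : 0 <= d q <= 1 by have := d_gt0 q; have := d_lt q; lra.
have d01' : 0 <= 1 - d q <= 1 by lra.
have m4 : (4 <= mate e)%N by rewrite /mate; case: ifP; lia.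
split; first exact: proj_mate.
have := ramp_edge g_pos d01' (mate_lt g_pos eN); rewrite subKr => ->.
rewrite (ramp_edge g_pos d01 eN).
by move: m4 e4; case: e {eN ce cm} => [|[|[|[|e]]]] //; case: (mate _) => [|[|[|[|]]]].
Qed.

Lemma corner_tile q k c : (c < 4)%N -> corner q (4 * k.+1 + c)%N =
  (q < (pr k.+1).1)%N || ((q < (pr k.+1).2)%N && (c != 3)).
Proof.
move=> c4; rewrite /corner mulnC divnMDl// divn_small// addn0 modnMDl modn_small//.
Qed.

Lemma mate_tile k c : (c < 4)%N -> mate (4 * k + c)%N = (4 * k + mate c)%N.
Proof.
move=> c4; rewrite /mate mulnC modnMDl; case: ifP => h; first by rewrite addnA.
by rewrite addnBA//; move: h; rewrite modn_small//; case: (c) => [|[|]].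
Qed.

Lemma tile_path q k : (k.+1 < g)%N ->
  path (link q) ((4 * k + 3)%N, false) (tile_keys q k.+1) /\
  last ((4 * k + 3)%N, false) (tile_keys q k.+1) = ((4 * k.+1 + 3)%N, false).
Proof.
move=> kg.
have enter : link q ((4 * k + 3)%N, false) ((4 * k.+1 + 0)%N, true).
  have -> : (4 * k.+1 + 0 = (4 * k + 3).+1)%N by lia.
  by apply: link_ray; rewrite (leq_trans _ (leq_addl _ _)).
have ray c : link q ((4 * k.+1 + c)%N, false) ((4 * k.+1 + c.+1)%N, true).
  by rewrite addnS; apply: link_ray; lia.
have glue c : (c < 4)%N -> corner q (4 * k.+1 + c)%N -> corner q (4 * k.+1 + mate c)%N ->
    link q ((4 * k.+1 + c)%N, true) ((4 * k.+1 + mate c)%N, false).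
  move=> c4 cc cm; rewrite -mate_tile//; apply: link_glue; rewrite ?mate_tile//.
  lia.
have midl c : ~~ corner q (4 * k.+1 + c)%N ->
    link q ((4 * k.+1 + c)%N, true) ((4 * k.+1 + c)%N, false) by exact: link_mid.
rewrite /tile_keys /tile_pattern; case: ifP => qi.
  have cor c : (c < 4)%N -> corner q (4 * k.+1 + c)%N by move=> c4; rewrite corner_tile// qi.
  split => //; rewrite /map /path /= enter !ray.
  by rewrite (@glue 0%N) ?(@glue 1%N) ?(@glue 2%N) ?(@glue 3%N) ?cor.
case: ifP => qj.
  have c3 : ~~ corner q (4 * k.+1 + 3)%N by rewrite corner_tile// qi qj.
  have cor c : (c < 3)%N -> corner q (4 * k.+1 + c)%N.
    by case: c => [|[|[|c]]] // _; rewrite corner_tile ?qi ?qj.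
  split => //; rewrite /map /path /= enter !ray midl// (@glue 0%N) ?cor//.
have cor c : (c < 4)%N -> ~~ corner q (4 * k.+1 + c)%N.
  by move=> c4; rewrite corner_tile// qi qj.
by split => //; rewrite /map /path /= enter !ray !midl// cor.
Qed.

Lemma strand_path q : path (link q) (2, false) (strand_keys q).
Proof.
have body h : forall k, (k + h < g)%N ->
    path (link q) ((4 * k + 3)%N, false)
      (flatten [seq tile_keys q j | j <- iota k.+1 h]) /\
    last ((4 * k + 3)%N, false)
      (flatten [seq tile_keys q j | j <- iota k.+1 h]) = ((4 * (k + h) + 3)%N, false).
  elim: h => [|h IH] k khg; first by rewrite addn0.
  have [|p1 l1] := @tile_path q k; first by apply: leq_ltn_trans khg; rewrite -addn1 leq_add2l.
  have [|p2 l2] := IH k.+1; first by rewrite addSnnS.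
  by rewrite /= cat_path last_cat p1 l1 p2 l2 addSnnS.
have [|p1 l1] := body g.-1 0%N; first by rewrite add0n prednK.
rewrite /strand_keys /= !link_ray//= link_mid//=.
rewrite cat_path p1 l1 /= andbT; have := link_last q.
by have -> : N.-1 = (4 * (0 + g.-1) + 3)%N by lia.
Qed.

(** The strand starts on the edge 2, where [ramp] is 1, and ends on the edge 0, where it is 0. *)
Lemma strand_essential q : essential_curve R (Sg R g) (strand q).
Proof.
have g4 : (4 <= N)%N by rewrite leq_pmulr.
have d01 : 0 <= d q <= 1 by have := d_gt0 q; have := d_lt q; lra.
have d01' : 0 <= 1 - d q <= 1 by lra.
have lastE : last (piece_of q (2, false)) (map (piece_of q) (strand_keys q)) =
    piece_of q (0%N, true).
  by rewrite last_map /strand_keys !last_cat.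
apply: (@pieces_essential _ _ g_pos (piece_of q (2, false))
  (map (piece_of q) (strand_keys q))).
- exact: strand_wf.
- by rewrite map_cons -map_comp map_id; exact: strand_keys_uniq.
- pose L := map (piece_of q) ((2, false) :: strand_keys q).
  move=> p1 p2 p1L p2L; have /mapP[[e s] _ ->] : p1 \in L := p1L.
  have /mapP[[e' s'] _ ->] : p2 \in L := p2L.
  move=> /= -> u v u01 v01 sum1.
  apply/eqP => swap; have [t1 t2] := swapped_touch u01 v01 sum1 swap.
  by have := touch_mate t1 t2; rewrite ltnn.
- by rewrite path_map; exact: strand_path.
- rewrite lastE plane_end plane_start.
  exact: (@proj_mate _ _ g_pos 0%N (d q) (leq_trans _ g4)).
- rewrite lastE plane_end plane_start (@ramp_edge _ _ g_pos 0%N)// ?(leq_trans _ g4)//.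
  have := @ramp_edge _ _ g_pos 2 (1 - d q) d01'; rewrite subKr => ->.
    by rewrite eq_sym oner_eq0.
  exact: leq_trans g4.
Qed.

Lemma strand_meet p q kp kq : kp \in (2, false) :: strand_keys p ->
  kq \in (2, false) :: strand_keys q ->
  proj (plane g (piece_of p kp) 0) = proj (plane g (piece_of q kq) 0) ->
  strand p `&` strand q <> set0.
Proof.
move=> kpS kqS pqE; have u01 : 0 <= (0 : R) < 1 by rewrite lexx ltr01.
apply/eqP/set0P; exists (proj (plane g (piece_of p kp) 0)); split.
  exact: mem_strand.
by rewrite pqE; exact: mem_strand.
Qed.

Lemma strand_meet_x p q : x p = x q -> strand p `&` strand q <> set0.
Proof.
move=> xpq; apply: (@strand_meet _ _ (3, true) (3, true)); rewrite ?inE//.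
by rewrite !plane_start /= /corner /xlev /= xpq.
Qed.

Lemma strand_meet_y p q : y p = y q -> strand p `&` strand q <> set0.
Proof.
move=> ypq; apply: (@strand_meet _ _ (3, false) (3, false)); rewrite ?inE//.
by rewrite !plane_start /= /corner /ylev /= ypq.
Qed.

(** Both strands start a piece at the midpoint of one of the two glued [b] edges, and the reversal
    [1 - t] fixes the parameter 1/2. *)
Lemma strand_meet_touch p q k : (0 < k < g)%N -> pr k = (p, q) -> (p < q)%N ->
  ~~ D p q -> strand p `&` strand q <> set0.
Proof.
have half : 0 <= (1 / 2 : R) <= 1 by apply/andP; split; lra.
have halfE : 1 - 1 / 2 = 1 / 2 :> R by lra.
move=> /andP[k0 kg] prk pq nD.
have tileS r c : c \in tile_pattern r k ->
    ((4 * k + c.1)%N, c.2) \in (2, false) :: strand_keys r.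
  move=> cr; rewrite /strand_keys inE !mem_cat; apply/or4P/Or43/flatten_mapP.
  by exists k; [rewrite mem_iota k0 /=; case: (g) g_pos kg|exact: map_f].
have touchT r c : (c < 4)%N -> touch r (4 * k + c)%N =
    ((c == 3) && (r == p) || (c == 1) && (r == q))%N.
  move=> c4; rewrite /touch mulnC divnMDl// divn_small// addn0 prk pq nD /=.
  rewrite modnMDl modn_small// andbC.
  by rewrite (leq_trans _ (leq_addr _ _)) ?andbT// mulnC leq_pmulr.
case: k k0 kg prk tileS touchT => // k _ kg prk tileS touchT.
have cp : corner p (4 * k.+1 + 3)%N = false by rewrite corner_tile// prk /= ltnn andbF.
have cq : corner q (4 * k.+1 + 1)%N = false.
  by rewrite corner_tile// prk /= ltnn /= ltnNge (ltnW pq).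
apply: (@strand_meet _ _ ((4 * k.+1 + 3)%N, false) ((4 * k.+1 + 1)%N, false)).
- by apply: (tileS p (3, false)); rewrite /tile_pattern prk /= ltnn pq.
- by apply: (tileS q (1, false)); rewrite /tile_pattern prk /= ltnn ltnNge (ltnW pq).
have e4 c : (4 * k.+1 + c < 4)%N = false.
  by apply/negbTE; rewrite -leqNgt (leq_trans _ (leq_addr _ _))// leq_pmulr.
rewrite !plane_start /ends cp cq /ylev !e4 !touchT//= !eqxx subr0.
have eN : (4 * k.+1 + 1 < N)%N by lia.
have := @proj_mate _ _ g_pos _ _ eN half; rewrite mate_tile//.
by rewrite halfE.
Qed.

End Strands.

(** * Realizing a graph *)

Section Realization.
Variables (R : realType).

(** The shift by 3 makes even the first depth positive, while all depths stay below 1/2. *)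
Definition depth (q : nat) : R := 1 / 2 - q.+3%:R^-1.

Lemma depth_mono p q : (p < q)%N -> depth p < depth q.
Proof.
by move=> pq; rewrite /depth ltrD2l ltrN2 ltf_pV2 ?posrE ?ltr0n// ltr_nat !ltnS.
Qed.

Lemma depth_gt0 q : 0 < depth q.
Proof.
rewrite /depth subr_gt0 mul1r ltf_pV2 ?posrE ?ltr0n//.
by rewrite (ltr_nat _ 2 q.+3).
Qed.

Lemma depth_lt q : depth q < 1 / 2.
Proof. by rewrite /depth ltrBlDr ltrDl invr_gt0 ltr0n. Qed.

Definition far_pairs (n : nat) : seq (nat * nat) :=
  rem (0, n.-1)%N [seq (i, j) | i <- iota 0 n, j <- iota i.+2 (n - i.+2)].

Lemma mem_all_far_pairs n i j : (i.+1 < j < n)%N ->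
  (i, j) \in [seq (i, j) | i <- iota 0 n, j <- iota i.+2 (n - i.+2)].
Proof.
move=> /andP[ij jn]; apply/allpairsPdep; exists i, j; split => //.
  by rewrite mem_iota /=; lia.
by rewrite mem_iota ij subnKC//; lia.
Qed.

Lemma mem_far_pairs n i j : (i.+1 < j < n)%N -> (i, j) != (0, n.-1)%N ->
  (i, j) \in far_pairs n.
Proof.
move=> ijn ne; have := mem_all_far_pairs ijn; rewrite /far_pairs.
set s := [seq _ | _ <- _, _ <- _] => ijs.
have [s0|s0] := boolP ((0, n.-1)%N \in s); last by rewrite rem_id.
by move: ijs; rewrite (perm_mem (perm_to_rem s0)) inE (negbTE ne).
Qed.

Lemma size_far_pairs n : (2 < n)%N -> (size (far_pairs n)).+1 = 'C(n.-1, 2).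
Proof.
move=> n2; rewrite /far_pairs size_rem; last by apply: mem_all_far_pairs; lia.
set s := [seq _ | _ <- _, _ <- _].
have sz : size s = 'C(n.-1, 2).
  rewrite size_allpairs_dep sumnE big_map.
  under eq_bigr do rewrite size_iota.
  have <- : index_iota 0 n = iota 0 n by rewrite /index_iota subn0.
  (* Read backwards, the row lengths become [i.-1]; without the first zero they are the numbers
     below [n.-1]. *)
  rewrite big_nat_rev /= add0n.
  rewrite (eq_big_nat _ _ (F2 := predn)); last by move=> i /andP[_ ni]; lia.
  by case: n n2 {s} => // m _; rewrite big_nat_recl//= add0n bin2_sum.
by rewrite sz prednK// bin_gt0; lia.
Qed.

Variables (n : nat) (D : nat -> nat -> bool).

(* At one of two places of the first handle, according to the parity of q,
   strand q descends to the level of strand q.+1 if the two must meet. *)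
Definition dip q := if D q q.+1 then depth q else depth q.+1.

Variable has_edge : bool.

(** Parity lets [q] dip at a place where [q.+1] keeps its own depth, so consecutive pairs are
    adjusted independently. Without edges the constant level makes all strands share a point. *)
Definition xdepth q := if has_edge then (if odd q then depth q else dip q) else depth 0.

Definition ydepth q := if odd q then dip q else depth q.

Lemma dip_bounds q : 0 < dip q < 1 / 2.
Proof. by rewrite /dip; case: ifP; rewrite depth_gt0 depth_lt. Qed.

Lemma dip_ge q : depth q <= dip q.
Proof. by rewrite /dip; case: ifP => _ //; apply/ltW/depth_mono. Qed.

(** Strand [p] dips to the level of [p.+1] only if these two must meet, and then [q] lies beyond
    [p.+1]. *)
Lemma dip_lt p q : (p < q)%N -> D p q -> dip p < depth q.
Proof.
move=> pq Dpq; rewrite /dip; case: ifP => [_|nD]; first exact: depth_mono.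
apply: depth_mono; rewrite ltn_neqAle pq andbT; apply: contraFneq nD => ->.
exact: Dpq.
Qed.

Lemma xdepth_lt p q : has_edge -> (p < q)%N -> D p q -> xdepth p < xdepth q.
Proof.
rewrite /xdepth => -> pq Dpq; apply: (@lt_le_trans _ _ (depth q)).
  by case: ifP => _; [exact: depth_mono|exact: dip_lt].
by case: ifP => _ //; exact: dip_ge.
Qed.

Lemma ydepth_lt p q : (p < q)%N -> D p q -> ydepth p < ydepth q.
Proof.
rewrite /ydepth => pq Dpq; apply: (@lt_le_trans _ _ (depth q)).
  by case: ifP => _; [exact: dip_lt|exact: depth_mono].
by case: ifP => _ //; exact: dip_ge.
Qed.
End Realization.

Lemma strands_realize (R : realType) (g n : nat) (D : nat -> nat -> bool) :
  (0 < g)%N -> (2 < n)%N -> ('C(n.-1, 2) <= g)%N ->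
  D 0%N n.-1 \/ (forall p q, D p q = false) ->
  exists f : nat -> set (Sg R g),
    [/\ forall q, essential_curve R (Sg R g) (f q),
        forall p q, p != q -> f p <> f q &
        forall p q, (p < q < n)%N -> (D p q <-> f p `&` f q = set0)].
Proof.
move=> g_pos n2 ng D0n.
pose he := `[< exists p q, D p q >].
pose x := xdepth R D he; pose y := ydepth R D.
(* Handles of pairs are numbered from 1. The default [(0, 0)] has no [i < j], so surplus handles
   produce no touching. *)
pose pr k := nth (0, 0)%N (far_pairs n) k.-1.
have x0 q : 0 < x q.
  rewrite /x /xdepth; case: ifP => _; last exact: depth_gt0.
  by case: ifP => _; rewrite ?depth_gt0//; case/andP: (dip_bounds R D q).
have x1 q : x q < 1 / 2.
  rewrite /x /xdepth; case: ifP => _; last exact: depth_lt.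
  by case: ifP => _; rewrite ?depth_lt//; case/andP: (dip_bounds R D q).
have y0 q : 0 < y q.
  by rewrite /y /ydepth; case: ifP => _; rewrite ?depth_gt0//; case/andP: (dip_bounds R D q).
have y1 q : y q < 1 / 2.
  by rewrite /y /ydepth; case: ifP => _; rewrite ?depth_lt//; case/andP: (dip_bounds R D q).
exists (strand g_pos (depth R) x y D pr); split.
- by move=> q; apply: strand_essential => //; [exact: depth_gt0|exact: depth_lt].
- move=> p q pq; apply: strand_neq => //; [exact: depth_gt0|exact: depth_lt|].
  exact: depth_mono.
move=> p q /andP[pq qn]; split => [Dpq|].
  have hE : he by apply/asboolP; exists p, q.
  apply: strand_disjoint => //; [exact: depth_gt0|exact: depth_lt|exact: depth_mono| |].
    exact: xdepth_lt.
  exact: ydepth_lt.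
apply: contraPT => nD.
have [hE|nE] := boolP he; last first.
  by apply: strand_meet_x; rewrite /x /xdepth (negbTE nE).
have D0 : D 0%N n.-1.
  by case: D0n => // F; move/asboolP: hE => [p' [q' ]]; rewrite F.
have [qE|qNE] := eqVneq q p.+1.
  have dipE : dip R D p = depth R q by move: nD; rewrite /dip qE => /negbTE->.
  have [op|op] := boolP (odd p).
    by apply: strand_meet_y; rewrite /y /ydepth op dipE qE /= op.
  by apply: strand_meet_x; rewrite /x /xdepth hE (negbTE op) dipE qE /= op.
have pq1 : (p.+1 < q < n)%N by rewrite ltn_neqAle eq_sym qNE pq.
(* The pair without a handle is an edge of the graph, hence not one that has to meet. *)
have ne : (p, q) != (0, n.-1)%N by apply: contraNneq nD => -[-> ->].
have inL := mem_far_pairs pq1 ne.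
apply: (@strand_meet_touch _ _ _ _ _ _ _ _ _ _ (index (p, q) (far_pairs n)).+1) => //.
  (* The far pairs and the first handle together number ['C(n.-1, 2)], so the handle of this pair
     exists. *)
  by apply: leq_trans ng; rewrite -(size_far_pairs n2) ltnS index_mem.
by rewrite /pr /= nth_index.
Qed.

(** * Numbering the vertices and counting handles *)

Lemma edge_numbering (V : finType) (e : rel V) (n : nat) :
  irreflexive e -> (#|V| <= n)%N ->
  exists i : V -> nat, [/\ injective i, forall v, (i v < n)%N &
    (forall u v, ~~ e u v) \/ exists u v, [/\ e u v, i u = 0%N & i v = n.-1]].
Proof.
move=> e_irr Vn.
case: (pickP [pred uv : V * V | e uv.1 uv.2]) => [[u v] /= euv|no_edge]; last first.
  exists (fun v => nat_of_ord (enum_rank v)); split => [u v|v|].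
  - by move=> /ord_inj/enum_rank_inj.
  - exact: leq_trans (ltn_ord _) Vn.
  - by left => u v; have /negbT := no_edge (u, v).
have uv : v != u by apply: contraTneq euv => ->; rewrite e_irr.
pose s := rem v (rem u (enum V)).
have mem_s w : w != u -> w != v -> w \in s.
  move=> wu wv; rewrite /s (mem_rem_uniq _ (rem_uniq _ (enum_uniq _))) inE wv /=.
  by rewrite (mem_rem_uniq _ (enum_uniq _)) inE wu mem_enum.
have sz : (size s).+2 = #|V|.
  have vs : v \in rem u (enum V).
    by rewrite (mem_rem_uniq _ (enum_uniq _)) inE mem_enum uv.
  have V2 : (1 < #|V|)%N by apply/card_gt1P; exists u, v; rewrite eq_sym.
  by rewrite /s size_rem// size_rem ?mem_enum// -cardE; case: #|V| V2 => [|[]].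
have idx w : w != u -> w != v -> ((index w s).+1 < n.-1)%N.
  move=> wu wv; have := mem_s w wu wv; rewrite -index_mem; lia.
(* The ends of the chosen edge get the extreme numbers; the other vertices fill the numbers from 1
   on and stay below [n.-1]. *)
exists (fun w => if w == u then 0%N else if w == v then n.-1 else (index w s).+1).
split=> [w w'|w|].
- case: (eqVneq w u) => [->|wu]; case: (eqVneq w' u) => [->|w'u] //.
  + by case: eqP => // _; lia.
  + by case: eqP => // _; lia.
  case: (eqVneq w v) => [->|wv]; case: (eqVneq w' v) => [->|w'v] //.
  + by have := idx w' w'u w'v; lia.
  + by have := idx w wu wv; lia.
  move=> [ww']; rewrite -(nth_index v (mem_s w wu wv)) ww'.
  by rewrite nth_index// mem_s.
- case: (eqVneq w u) => [_|wu]; first by lia.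
  case: (eqVneq w v) => [_|wv]; first by lia.
  by have := idx w wu wv; lia.
- by right; exists u, v; rewrite !eqxx (negbTE uv).
Qed.

Theorem theorem1p4 (R : realType) (V : finType) (e : rel V)
    (e_sym : symmetric e) (e_irr : irreflexive e) (g : nat)
    (g_pos : (0 < g)%N) (g_bound : ('C(#|V|, 2) + 1 <= g + #|V|)%N) :
  induced_in_fine_curve_graph R (Sg R g) V e.
Proof.
pose n := maxn 3 #|V|.
have n2 : (2 < n)%N by rewrite leq_max.
(* Up to three vertices, one handle suffices; beyond that, Pascal's rule turns the assumed bound
   into ['C(#|V|.-1, 2) <= g]. *)
have ng : ('C(n.-1, 2) <= g)%N.
  rewrite /n; case: (leqP #|V| 3) => // V3.
  have [m mE] : exists m, #|V| = m.+1 by exists #|V|.-1; rewrite prednK// (leq_trans _ V3).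
  by move: g_bound; rewrite mE binS bin1 /= addn1; lia.
have [i [i_inj i_lt i_edge]] := @edge_numbering V e n e_irr (leq_maxr _ _).
pose D p q := [exists u, exists v, [&& i u == p, i v == q & e u v]].
have DE u v : D (i u) (i v) = e u v.
  apply/existsP/idP => [[u' /existsP[v' /and3P[/eqP/i_inj-> /eqP/i_inj->]]]//|euv].
  by exists u; apply/existsP; exists v; rewrite !eqxx.
have D0n : D 0%N n.-1 \/ forall p q, D p q = false.
  case: i_edge => [no_edge|[u [v [euv <- <-]]]]; [right|by left; rewrite DE].
  move=> p q; apply/negbTE/existsPn => u; apply/existsPn => v.
  by rewrite !negb_and no_edge !orbT.
have [f [f_ess f_inj f_adj]] := @strands_realize R g n D g_pos n2 ng D0n.
exists (f \o i); split=> [u v|].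
  by move=> /= fuv; apply: i_inj; apply/eqP; apply: contraT => /f_inj.
split=> [u|u v uv]; first exact: f_ess.
have : i u != i v by apply: contraNneq uv => /i_inj->.
rewrite neq_ltn => /orP[] iuv /=.
  by rewrite -DE; apply: f_adj; rewrite iuv i_lt.
by rewrite e_sym setIC -DE; apply: f_adj; rewrite iuv i_lt.
Qed.
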